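(* Let $R$ be a commutative Noetherian local ring in which $2$ is invertible and let $m\ge 2$. Then the quotient group $$\frac{\mathrm{SO}_{2m+1}(R[X])}{\mathrm{EO}_{2m+1}(R[X])}$$ is solvable of length at most $2$.
   Context: For a commutative ring $A$ with $2$ invertible and matrix units $e_{i,j}$, put $\tilde\phi_{2r}=\sum_{i=1}^r(e_{2i-1,2i}+e_{2i,2i-1})$ and $\tilde\phi_{2r+1}=(2)\perp\tilde\phi_{2r}$, where $\perp$ denotes block diagonal sum. $\mathrm{O}_n(A)=\{\alpha\in\mathrm{GL}_n(A):\alpha^t\tilde\phi_n\alpha=\tilde\phi_n\}$, and $\mathrm{SO}_n(A)$ is its subgroup of matrices of determinant $1$. For $z\in A$ and $1\le i\le r$, writing $e_{k,l}(z)=z e_{k,l}$, set $$F^1_i(z)=I_{2r+1}+e_{1,2i+1}(z)-e_{2i,1}(2z)-e_{2i,2i+1}(z^2),$$ $$F^2_i(z)=I_{2r+1}+e_{1,2i}(z)-e_{2i+1,1}(2z)-e_{2i+1,2i}(z^2).$$ $\mathrm{EO}_{2r+1}(A)$ is the subgroup of $\mathrm{O}_{2r+1}(A)$ generated by all $F^1_i(z),F^2_i(z)$, $1\le i\le r$, $z\in A$. A group $G$ is solvable of length at most $2$ if $[[G,G],[G,G]]=\{e\}$. *)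

(* Defs.v *)
From HB Require Import structures.
From mathcomp Require Import all_boot all_order all_algebra.
From mathcomp Require Import zify ring.
From mathcomp Require Import boolp classical_sets.

Set Implicit Arguments.
Unset Strict Implicit.
Unset Printing Implicit Defensive.

Import GRing.Theory.
Local Open Scope classical_set_scope.
Local Open Scope ring_scope.

Section CommutativeRings.
Variable R : comNzRingType.

Definition invertible (x : R) := exists y, x * y = 1.

Definition ideal (I : set R) :=
  [/\ I 0, (forall x y, I x -> I y -> I (x + y))
         & (forall a x, I x -> I (a * x))].

Definition finitely_generated (I : set R) :=
  exists s : seq R, I = smallest ideal [set` s].

Definition noetherian := forall I, ideal I -> finitely_generated I.

Definition maximal_ideal (M : set R) :=
  [/\ ideal M, M <> setT
    & forall J, ideal J -> M `<=` J -> J = M \/ J = setT].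

Definition local_ring := exists! M : set R, maximal_ideal M.

End CommutativeRings.

Section Groups.
Variable G : groupType.
Implicit Types (g x y : G) (A B N H : set G).
Local Open Scope group_scope.

Definition subgroup H :=
  [/\ H 1, (forall x y, H x -> H y -> H (x * y)) & (forall x, H x -> H x^-1)].

Definition generated A : set G := smallest subgroup A.

Definition commutator_subgroup A B : set G :=
  generated [set [~ x, y] | x in A & y in B].

Definition solvable_length_le2 :=
  let D := commutator_subgroup setT setT in
  commutator_subgroup D D = [set 1].

Definition normal_subgroup N H :=
  [/\ subgroup H, subgroup N, N `<=` H
    & forall x y, N x -> H y -> N (x ^ y)].

Definition lcoset g N : set G := [set g * x | x in N].
Definition setprod A B : set G := [set x * y | x in A & y in B].
Definition setinv A : set G := [set x^-1 | x in A].

End Groups.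

Section QuotientGroup.
Variables (G : groupType) (N H : set G).
Hypothesis nNH : normal_subgroup N H.
Local Open Scope group_scope.

Definition is_coset (C : set G) : bool :=
  `[< exists2 g, H g & C = lcoset g N >].

(* H / N, with the cosets themselves as elements; the normality proof is a
   parameter, so that the type carries a group structure. *)
Record quotient_group (nNH : normal_subgroup N H) :=
  Quotient { coset_val : set G; coset_valP : is_coset coset_val }.

Local Notation Q := (quotient_group nNH).

HB.instance Definition _ := [isSub of Q for @coset_val nNH].
HB.instance Definition _ := [Choice of Q by <:].

Lemma setprod_lcoset x y : H y ->
  setprod (lcoset x N) (lcoset y N) = lcoset (x * y) N.
Proof.
case: nNH => _ [N1 NM NV] _ NJ Hy; apply/seteqP; split.
  move=> _ [_ [a Na <-]] [_ [b Nb <-]] <-; exists (a ^ y * b).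
    by apply: NM => //; apply: NJ.
  by rewrite conjgE !mulgA mulgK.
move=> _ [n Nn <-]; exists x; first by exists 1; rewrite ?mulg1.
by exists (y * n); [exists n | rewrite mulgA].
Qed.

Lemma setinv_lcoset x : H x -> setinv (lcoset x N) = lcoset x^-1 N.
Proof.
case: nNH => -[_ _ HV] [_ _ NV] _ NJ Hx; apply/seteqP; split.
  move=> _ [_ [n Nn <-] <-]; exists (n^-1 ^ x^-1).
    by apply: NJ; [apply: NV | apply: HV].
  by rewrite conjgE invgM invgK !mulgA mulVg mul1g.
move=> _ [n Nn <-]; exists (x * n^-1 ^ x).
  by exists (n^-1 ^ x) => //; apply: NJ => //; apply: NV.
by rewrite conjgE !mulgA mulgV mul1g invgM invgK.
Qed.

Lemma lcoset1 : lcoset 1 N = N.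
Proof.
apply/seteqP; split=> [_ [n Nn <-]|n Nn]; first by rewrite mul1g.
by exists n; rewrite ?mul1g.
Qed.

Lemma one_subproof : is_coset N.
Proof.
have [[H1 _ _] _ _ _] := nNH.
by apply/asboolP; exists 1; rewrite ?lcoset1.
Qed.

Lemma quoP (C : Q) : exists2 x, H x & val C = lcoset x N.
Proof. exact: (asboolW (coset_valP C)). Qed.

Lemma mul_subproof (C D : Q) : is_coset (setprod (val C) (val D)).
Proof.
have [[_ HM _] _ _ _] := nNH.
have [x Hx ->] := quoP C; have [y Hy ->] := quoP D.
by apply/asboolP; exists (x * y); [apply: HM | rewrite setprod_lcoset].
Qed.

Lemma inv_subproof (C : Q) : is_coset (setinv (val C)).
Proof.
have [[_ _ HV] _ _ _] := nNH; have [x Hx ->] := quoP C.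
by apply/asboolP; exists x^-1; [apply: HV | rewrite setinv_lcoset].
Qed.

Definition quo_one : Q := Quotient nNH one_subproof.
Definition quo_mul (C D : Q) : Q := Quotient nNH (mul_subproof C D).
Definition quo_inv (C : Q) : Q := Quotient nNH (inv_subproof C).

Lemma quo_mulA : associative quo_mul.
Proof.
have [[_ HM _] _ _ _] := nNH; move=> C D E; apply: val_inj => /=.
have [x Hx ->] := quoP C; have [y Hy ->] := quoP D.
have [z Hz ->] := quoP E.
by rewrite !setprod_lcoset ?mulgA //; apply: HM.
Qed.

Lemma quo_mul1 : left_id quo_one quo_mul.
Proof.
move=> C; apply: val_inj => /=; have [x Hx ->] := quoP C.
by rewrite -{1}lcoset1 setprod_lcoset // mul1g.
Qed.

Lemma quo_mulr1 : right_id quo_one quo_mul.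
Proof.
have [[H1 _ _] _ _ _] := nNH; move=> C; apply: val_inj => /=.
have [x Hx ->] := quoP C.
by rewrite -{2}lcoset1 setprod_lcoset // mulg1.
Qed.

Lemma quo_mulV : left_inverse quo_one quo_inv quo_mul.
Proof.
move=> C; apply: val_inj; rewrite /= -[RHS]lcoset1; have [x Hx ->] := quoP C.
by rewrite setinv_lcoset // setprod_lcoset // mulVg.
Qed.

Lemma quo_mulrV : right_inverse quo_one quo_inv quo_mul.
Proof.
have [[_ _ HV] _ _ _] := nNH; move=> C; apply: val_inj; rewrite /= -[RHS]lcoset1.
have [x Hx ->] := quoP C.
by rewrite setinv_lcoset // setprod_lcoset ?mulgV //; apply: HV.
Qed.

HB.instance Definition _ :=
  isGroup.Build Q quo_mulA quo_mul1 quo_mulr1 quo_mulV quo_mulrV.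

End QuotientGroup.

Section GeneralLinear.
Variables (n : nat) (A : comNzRingType).

(* GL_n(A) over an arbitrary commutative ring; each element stores its (unique)
   inverse, since unitmx requires a unitRingType, which {poly R} is not in
   general. *)
Definition is_inverse_pair (p : 'M[A]_n * 'M[A]_n) : bool :=
  (p.1 *m p.2 == 1%:M) && (p.2 *m p.1 == 1%:M).

Record GL := MkGL {
  GLpair : 'M[A]_n * 'M[A]_n;
  GLpairP : is_inverse_pair GLpair
}.

HB.instance Definition _ := [isSub of GL for GLpair].
HB.instance Definition _ := [Choice of GL by <:].

Definition GLmx (g : GL) : 'M[A]_n := (val g).1.

Lemma GL_one_subproof : is_inverse_pair (1%:M, 1%:M).
Proof. by rewrite /is_inverse_pair /= mulmx1 eqxx. Qed.

Lemma GL_mul_subproof (g h : GL) :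
  is_inverse_pair (GLmx g *m GLmx h, (val h).2 *m (val g).2).
Proof.
move: (GLpairP g) (GLpairP h); rewrite /is_inverse_pair /GLmx /=.
case: (GLpair g) (GLpair h) => a b [c d] /= /andP[/eqP ab /eqP ba].
case/andP=> /eqP cd /eqP dc.
by rewrite -!mulmxA [c *m _]mulmxA cd [b *m _]mulmxA ba !mul1mx ab dc !eqxx.
Qed.

Lemma GL_inv_subproof (g : GL) : is_inverse_pair ((val g).2, (val g).1).
Proof. by case: g => p /=; rewrite /is_inverse_pair andbC. Qed.

Definition GL_one : GL := MkGL GL_one_subproof.
Definition GL_mul (g h : GL) : GL := MkGL (GL_mul_subproof g h).
Definition GL_inv (g : GL) : GL := MkGL (GL_inv_subproof g).

Lemma GLmx_inj : injective GLmx.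
Proof.
move=> [[a b] ab] [[a' c] ac]; rewrite /GLmx /= => eq_a; apply: val_inj => /=.
move: ab ac; rewrite -{a'}eq_a => /andP[_ /eqP /= ba] /andP[/eqP /= ac _].
by rewrite -[b]mulmx1 -ac mulmxA ba mul1mx.
Qed.

Lemma GL_mulA : associative GL_mul.
Proof. by move=> f g h; apply: GLmx_inj; rewrite /GLmx /= mulmxA. Qed.

Lemma GL_mul1 : left_id GL_one GL_mul.
Proof. by move=> g; apply: GLmx_inj; rewrite /GLmx /= mul1mx. Qed.

Lemma GL_mulr1 : right_id GL_one GL_mul.
Proof. by move=> g; apply: GLmx_inj; rewrite /GLmx /= mulmx1. Qed.

Lemma GL_mulV : left_inverse GL_one GL_inv GL_mul.
Proof.
by move=> g; apply: GLmx_inj; case/andP: (GLpairP g) => _ /eqP.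
Qed.

Lemma GL_mulrV : right_inverse GL_one GL_inv GL_mul.
Proof.
by move=> g; apply: GLmx_inj; case/andP: (GLpairP g) => /eqP.
Qed.

HB.instance Definition _ :=
  isGroup.Build GL GL_mulA GL_mul1 GL_mulr1 GL_mulV GL_mulrV.

(* The matrix unit e_{k,l}, with 1-based indices. *)
Definition munit (k l : nat) : 'M[A]_n :=
  \matrix_(i, j) ((i.+1 == k) && (j.+1 == l))%:R.

Lemma mul_munit k l p q : (0 < l <= n)%N ->
  munit k l *m munit p q = (l == p)%:R *: munit k q.
Proof.
case: l => // l ltln; apply/matrixP=> i j; rewrite !mxE.
rewrite (bigD1 (Ordinal ltln)) //= big1 => [|s /eqP s_l]; rewrite !mxE /=.
  rewrite addr0 eqxx andbT.
  by case: (_ == p); case: (_ == k); case: (_ == q);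
    rewrite ?(mulr1, mul1r, mulr0, mul0r).
have /negPf -> : s.+1 != l.+1 by apply/eqP=> -[sl]; apply/s_l/val_inj.
by rewrite andbF mul0r.
Qed.

Definition orthogonal_group (phi : 'M[A]_n) : set GL :=
  [set g | (GLmx g)^T *m phi *m GLmx g = phi].

Lemma subgroup_orthogonal phi : subgroup (orthogonal_group phi).
Proof.
split=> [|g h Og Oh|g Og].
- by rewrite /orthogonal_group /GLmx /= trmx1 mul1mx mulmx1.
- rewrite /orthogonal_group /= -[RHS]Oh -[in RHS]Og.
  change (GLmx (g * h)%g) with (GLmx g *m GLmx h).
  by rewrite trmx_mul !mulmxA.
have /andP[/eqP gV _] := GLpairP g; rewrite /orthogonal_group /=.
rewrite -{1}[phi]Og -!mulmxA gV mulmx1 mulmxA -trmx_mul.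
by rewrite gV trmx1 mul1mx.
Qed.

Definition special_orthogonal_group (phi : 'M[A]_n) : set GL :=
  orthogonal_group phi `&` [set g | \det (GLmx g) = 1].

End GeneralLinear.

Section OddOrthogonal.
Variables (A : comNzRingType) (r : nat).
Local Notation n := (2 * r).+1.
Local Notation e := (munit n A).

Definition phi_even : 'M[A]_(2 * r) :=
  \sum_(1 <= i < r.+1)
    (munit _ A (2 * i).-1 (2 * i) + munit _ A (2 * i) (2 * i).-1).

Definition phi_odd : 'M[A]_n :=
  block_mx (2%:R)%:M (0 : 'M_(1, 2 * r)) (0 : 'M_(2 * r, 1)) phi_even.

Definition O_odd : set (GL n A) := orthogonal_group phi_odd.
Definition SO_odd : set (GL n A) := special_orthogonal_group phi_odd.

Definition F1mx (i : nat) (z : A) : 'M[A]_n :=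
  1%:M + z *: e 1 (2 * i).+1 - (2%:R * z) *: e (2 * i) 1
       - (z ^+ 2) *: e (2 * i) (2 * i).+1.

Definition F2mx (i : nat) (z : A) : 'M[A]_n :=
  1%:M + z *: e 1 (2 * i) - (2%:R * z) *: e (2 * i).+1 1
       - (z ^+ 2) *: e (2 * i).+1 (2 * i).


Lemma phi_oddE :
  phi_odd = 2%:R *: e 1 1
    + \sum_(1 <= i < r.+1) (e (2 * i) (2 * i).+1 + e (2 * i).+1 (2 * i)).
Proof.
have e0l (k l : nat) (j j' : 'I_n) : (1 < k)%N -> val j = 0%N -> e k l j j' = 0.
  by move=> k1 j0; rewrite mxE j0 ltn_eqF.
have e0r (k l : nat) (j j' : 'I_n) : (1 < l)%N -> val j' = 0%N -> e k l j j' = 0.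
  by move=> l1 j0; rewrite mxE j0 (ltn_eqF l1) andbF.
have gt1 i : (1 <= i)%N -> (1 < 2 * i)%N by case: i => // i _; rewrite mulnS.
apply/matrixP=> a b; rewrite [RHS]mxE summxE.
case: (@split_ordP 1 _ a) => a' ->; case: (@split_ordP 1 _ b) => b' ->.
- rewrite [LHS]block_mxEul !mxE !ord1 mulr1n mulr1.
  rewrite big_nat big1 ?addr0 // => i /andP[/gt1 i1 _].
  by rewrite mxE !e0l // ?addr0 // ltnW.
- rewrite [LHS]block_mxEur !mxE ord1 /= mulr0.
  rewrite big_nat big1 ?addr0 // => i /andP[/gt1 i1 _].
  by rewrite mxE !e0l // ?addr0 // ltnW.
- rewrite [LHS]block_mxEdl !mxE ord1 /= mulr0.
  rewrite big_nat big1 ?addr0 // => i /andP[/gt1 i1 _].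
  by rewrite mxE !e0r // ?addr0 // ltnW.
rewrite [LHS]block_mxEdr !mxE /= mulr0 add0r /phi_even summxE.
apply: eq_big_nat => i /andP[i1 _].
rewrite !mxE /= !add1n; case: (2 * i)%N (gt1 i i1) => // k _ /=.
Qed.


Section Transvection.
Variables p q : nat.
Hypotheses (p_gt1 : (1 < p)%N) (le_pn : (p <= n)%N).
Hypotheses (q_gt1 : (1 < q)%N) (le_qn : (q <= n)%N) (neq_pq : p != q).

Let F z : 'M[A]_n :=
  1%:M + z *: e 1 q - (2%:R * z) *: e p 1 - (z ^+ 2) *: e p q.

Let p0 : (0 < p)%N. Proof. exact: ltnW. Qed.
Let q0 : (0 < q)%N. Proof. exact: ltnW. Qed.
Let np1 : (p == 1%N) = false. Proof. by rewrite gtn_eqF. Qed.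
Let nq1 : (q == 1%N) = false. Proof. by rewrite gtn_eqF. Qed.
Let n1p : (1%N == p) = false. Proof. by rewrite ltn_eqF. Qed.
Let n1q : (1%N == q) = false. Proof. by rewrite ltn_eqF. Qed.
Let npq : (p == q) = false. Proof. exact: negPf. Qed.
Let nqp : (q == p) = false. Proof. by rewrite eq_sym. Qed.

Lemma mul_FN z : F z *m F (- z) = 1%:M.
Proof.
rewrite /F !(mulmxDl, mulmxDr, mulNmx, mulmxN, mul1mx, mulmx1).
rewrite -!(scalemxAl, scalemxAr) !mul_munit ?p0 ?q0 ?le_pn ?le_qn //.
rewrite !eqxx ?(np1, nq1, n1p, n1q, npq, nqp); apply/matrixP=> i j; rewrite !mxE.
rewrite mulr0n mulr1n; ring.
Qed.

Hypothesis phi_p : forall l, phi_odd *m e p l = e q l.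

Lemma FT_phi_F z : (F z)^T *m phi_odd *m F z = phi_odd.
Proof.
have tr_e k l : (e k l)^T = e l k by apply/matrixP=> i j; rewrite !mxE andbC.
have phiT : phi_odd^T = phi_odd.
  rewrite phi_oddE linearD linearZ /= tr_e linear_sum; congr (_ + _).
  by apply: eq_bigr => i _; rewrite linearD /= !tr_e addrC.
have phi_1 l : phi_odd *m e 1 l = 2%:R *: e 1 l.
  rewrite phi_oddE mulmxDl -scalemxAl mul_munit // eqxx scale1r mulmx_suml.
  rewrite big_nat big1 ?addr0 // => -[|i] // /andP[_ ltir].
  rewrite mulmxDl !mul_munit ?mulnS ?scale0r ?addr0 //=.
    by rewrite !ltnS; lia.
  by rewrite !ltnS; lia.
have p_phi l : e l p *m phi_odd = e l q.
  by rewrite -phiT -[e l p]tr_e -trmx_mul phi_p tr_e.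
have one_phi l : e l 1 *m phi_odd = 2%:R *: e l 1.
  by rewrite -phiT -[e l 1]tr_e -trmx_mul phi_1 linearZ /= tr_e.
have -> : (F z)^T
    = 1%:M + z *: e q 1 - (2%:R * z) *: e 1 p - (z ^+ 2) *: e q p.
  by rewrite /F !(linearB, linearD) /= !linearZ /= !tr_e trmx1.
rewrite !(mulmxDl, mulNmx, mul1mx) -!scalemxAl p_phi one_phi p_phi.
rewrite /F !(mulmxDr, mulmxN, mulmx1) -!(scalemxAl, scalemxAr).
rewrite phi_1 !phi_p !mul_munit ?p0 ?q0 ?le_pn ?le_qn //.
rewrite !eqxx ?(np1, nq1, n1p, n1q, npq, nqp); apply/matrixP=> i j.
set M := phi_odd; rewrite !(mxE, mulr0n, mulr1n); ring.
Qed.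

Lemma F_in_O z : exists2 g, O_odd g & GLmx g = F z.
Proof.
have F_inv : is_inverse_pair (F z, F (- z)).
  by rewrite /is_inverse_pair /= mul_FN -{2}[z]opprK mul_FN !eqxx.
by exists (MkGL F_inv); [apply: FT_phi_F | ].
Qed.

End Transvection.

Lemma phi_munit k l : (1 < k <= n)%N ->
  phi_odd *m e k l = \sum_(1 <= i < r.+1)
    (((2 * i).+1 == k)%:R *: e (2 * i) l + ((2 * i) == k)%:R *: e (2 * i).+1 l).
Proof.
move=> /andP[k1 _]; rewrite phi_oddE mulmxDl -scalemxAl mul_munit //.
rewrite ltn_eqF // scale0r scaler0 add0r mulmx_suml.
by apply: eq_big_nat => i ir; rewrite mulmxDl !mul_munit //; lia.
Qed.

Lemma phi_munit_even i l : (1 <= i <= r)%N ->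
  phi_odd *m e (2 * i) l = e (2 * i).+1 l.
Proof.
move=> ir; rewrite phi_munit; last by lia.
rewrite (bigD1_seq i) ?mem_index_iota ?iota_uniq //= big1_seq => [|j /andP[ji _]].
  by rewrite eqxx scale1r gtn_eqF // scale0r add0r addr0.
have -> : ((2 * j).+1 == 2 * i)%N = false by lia.
by have -> : (2 * j == 2 * i)%N = false; [lia | rewrite !scale0r addr0].
Qed.

Lemma phi_munit_odd i l : (1 <= i <= r)%N ->
  phi_odd *m e (2 * i).+1 l = e (2 * i) l.
Proof.
move=> ir; rewrite phi_munit; last by lia.
rewrite (bigD1_seq i) ?mem_index_iota ?iota_uniq //= big1_seq => [|j /andP[ji _]].
  by rewrite eqxx scale1r ltn_eqF // scale0r !addr0.
have -> : (2 * j == (2 * i).+1)%N = false by lia.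
by have -> : ((2 * j).+1 == (2 * i).+1)%N = false; [lia | rewrite !scale0r addr0].
Qed.

Lemma F1_in_O i z : (1 <= i <= r)%N -> exists2 g, O_odd g & GLmx g = F1mx i z.
Proof.
move=> ir; apply: F_in_O; try lia; by move=> l; apply: phi_munit_even.
Qed.

Lemma F2_in_O i z : (1 <= i <= r)%N -> exists2 g, O_odd g & GLmx g = F2mx i z.
Proof.
move=> ir; apply: F_in_O; try lia; by move=> l; apply: phi_munit_odd.
Qed.

Definition EO_generators : set (GL n A) :=
  [set g | exists i z, (1 <= i <= r)%N /\
                       (GLmx g = F1mx i z \/ GLmx g = F2mx i z)].

Definition EO_odd : set (GL n A) := generated EO_generators.

Lemma EO_sub_O : EO_odd `<=` O_odd.
Proof.
apply: smallest_sub; first exact: subgroup_orthogonal.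
by move=> g [i [z [ir []]]]; [have [h Oh <-] := F1_in_O z ir
  | have [h Oh <-] := F2_in_O z ir]; move=> /GLmx_inj->.
Qed.

End OddOrthogonal.

Arguments O_odd A r : clear implicits.
Arguments SO_odd A r : clear implicits.
Arguments EO_odd A r : clear implicits.

(* Main.v *)
From HB Require Import structures.
Require Import Defs.
From mathcomp Require Import all_boot all_order all_algebra.
From mathcomp Require Import zify ring generic_quotient.
From mathcomp Require Import boolp classical_sets.

Set Implicit Arguments.
Unset Strict Implicit.
Unset Printing Implicit Defensive.

Import GRing.Theory.
Local Open Scope ring_scope.

(** Write V for the free module with the form phi_odd; its basis consists of an
anisotropic vector o and of hyperbolic vectors h p.  For u isotropic and v
orthogonal to u there is an Eichler transvection E(u, v); it is additive in v
and satisfies g E(u, v) g^-1 = E(g u, g v) for g orthogonal.  The generators of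
EO are exactly the E(h p, c o).

The algebraic heart is [elementary_eichler_pow]: for every isotropic u and every
v orthogonal to u, the transvection E(u, a^4 v) is a product of generators as
soon as a is a hyperbolic coordinate of u.  It is proved by Suslin's method:
a multiple of v is decomposed into Koszul vectors orthogonal to u, each of which
involves only two basis vectors.  Nothing is assumed about a, so the lemma can
be used with denominators: if C -> D is a localization at S and g is orthogonal
over D, then g E(h p, s c o) g^-1 comes from an elementary matrix over C for
some s in S and all c in C ([loc_conj]).  For C = D this says that EO is normal
in the orthogonal group; in general it is what Quillen's and Suslin's patching
method needs ([loc_elementary]): a matrix M(Y) over C[Y] with M(0) = 1 that is
elementary over D[Y] has M(sY) elementary over C[Y] for some s in S.

Over a local ring every orthogonal matrix is elementary up to a matrix that is
diagonal in the basis o, h p ([local_decomposition]); diagonal matrices commute,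
so commutators are elementary there.  Hence the commutators of SO(R[X]) lie in
the subgroup K of matrices that become elementary under every ring morphism to a
local ring, and it suffices to show that a commutator [a, b] of two elements of
K is elementary.  Dividing a by a(0), which is elementary because R is local,
one may assume a(0) = 1.  Consider the values a(t) for t in A = R[X].  The s in A
such that [a(t), b] elementary implies [a(t + s y), b] elementary, for all t
and y, form an ideal.  For each maximal ideal M, the matrix b is elementary over
A_M, so that [a(T)^-1 a(T + Y), b] is elementary over A_M[T][Y] and equal to 1
at Y = 0; the patching statement puts an element outside M into the ideal
([comm_at_local]).  The ideal is therefore A, and one passes from t = 0 to
t = X. *)

(** * Eichler transvections *)

Section Eichler.
Variables (A : comNzRingType) (n : nat) (phi : 'M[A]_n) (hf : A).
Hypotheses (phi_sym : phi^T = phi) (hf2 : 2%:R * hf = 1).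
Implicit Types (u v w x y : 'cV[A]_n) (g : 'M[A]_n) (a b c : A).

Definition bil x y : A := (x^T *m phi *m y) 0 0.

Lemma bilC x y : bil x y = bil y x.
Proof.
rewrite /bil -[in LHS]phi_sym; have -> : x^T *m phi^T *m y = (y^T *m phi *m x)^T.
  by rewrite !trmx_mul trmxK mulmxA.
by rewrite mxE.
Qed.

Lemma bilDr x y z : bil x (y + z) = bil x y + bil x z.
Proof. by rewrite /bil mulmxDr mxE. Qed.

Lemma bilZr c x y : bil x (c *: y) = c * bil x y.
Proof. by rewrite /bil -scalemxAr mxE. Qed.

Lemma bilNr x y : bil x (- y) = - bil x y.
Proof. by rewrite /bil mulmxN mxE. Qed.

Lemma bil0r x : bil x 0 = 0.
Proof. by rewrite /bil mulmx0 mxE. Qed.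

Lemma bilDl x y z : bil (x + y) z = bil x z + bil y z.
Proof. by rewrite !(bilC _ z) bilDr. Qed.

Lemma bilZl c x y : bil (c *: x) y = c * bil x y.
Proof. by rewrite !(bilC _ y) bilZr. Qed.

Lemma bilNl x y : bil (- x) y = - bil x y.
Proof. by rewrite !(bilC _ y) bilNr. Qed.

Lemma bil_sumr (I : finType) (P : pred I) x (F : I -> 'cV[A]_n) :
  bil x (\sum_(i | P i) F i) = \sum_(i | P i) bil x (F i).
Proof.
by apply: (big_ind2 (fun y b => bil x y = b)); rewrite ?bil0r // => ? ? ? ? <- <-;
  rewrite bilDr.
Qed.

Definition bilE := (bilDr, bilDl, bilNr, bilNl, bilZr, bilZl).

Definition qf v := hf * bil v v.

(** The Eichler (or Siegel) transvection; it is orthogonal when u is isotropic and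
orthogonal to v. *)
Definition eichler u v : 'M[A]_n :=
  1%:M + u *m v^T *m phi - v *m u^T *m phi - qf v *: (u *m u^T *m phi).

Lemma mx_ext (M N : 'M[A]_n) : (forall x : 'cV_n, M *m x = N *m x) -> M = N.
Proof.
move=> eqMN; apply/matrixP=> i j; have := congr1 (fun x => x i 0) (eqMN (delta_mx j 0)).
by rewrite -!colE !mxE.
Qed.

Lemma outer_mul u v x : u *m v^T *m phi *m x = bil v x *: u.
Proof. by rewrite -!mulmxA [_ *m (phi *m x)]mx11_scalar mul_mx_scalar /bil mulmxA. Qed.

Lemma eichlerE u v x :
  eichler u v *m x = x + bil v x *: u - bil u x *: v - (qf v * bil u x) *: u.
Proof.
by rewrite /eichler !(mulmxDl, mulNmx) mul1mx -scalemxAl !outer_mul scalerA.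
Qed.

Lemma bil_qf v : bil v v = 2%:R * qf v.
Proof. by rewrite /qf mulrA hf2 mul1r. Qed.

Lemma qfD v w : qf (v + w) = qf v + bil v w + qf w.
Proof.
rewrite /qf !bilE (bilC w v) -[bil v w in RHS]mul1r -hf2; ring.
Qed.

Lemma qfZ c v : qf (c *: v) = c ^+ 2 * qf v.
Proof. by rewrite /qf !bilE; ring. Qed.

Lemma eichler0 u : eichler u 0 = 1%:M.
Proof.
by rewrite /eichler /qf trmx0 !(mulmx0, mul0mx) bil0r mulr0 scale0r !(subr0, addr0).
Qed.

Lemma eichlerZ c u v : eichler (c *: u) v = eichler u (c *: v).
Proof.
apply: mx_ext => x; rewrite !eichlerE qfZ !bilE; apply/matrixP=> i j.
rewrite !mxE; ring.
Qed.

Lemma eichlerD u v w : bil u u = 0 -> bil u v = 0 -> bil u w = 0 ->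
  eichler u (v + w) = eichler u v *m eichler u w.
Proof.
move=> uu uv uw; apply: mx_ext => x; rewrite -mulmxA !eichlerE qfD !bilE.
rewrite (bilC v u) uu uv uw; apply/matrixP=> i j; rewrite !mxE; ring.
Qed.

Lemma eichlerS u c : bil u u = 0 -> eichler u (c *: u) = 1%:M.
Proof.
move=> uu; apply: mx_ext => x; rewrite eichlerE qfZ /qf uu mulr0 !bilE mul1mx.
apply/matrixP=> i j; rewrite !mxE; ring.
Qed.

Lemma eichlerN u v : bil u u = 0 -> bil u v = 0 ->
  eichler u v *m eichler u (- v) = 1%:M.
Proof. by move=> uu uv; rewrite -eichlerD ?bilNr ?uv ?oppr0 // subrr eichler0. Qed.

(** The transvection is not additive in its first argument: the correction
E(x, q(v) y) is again a transvection, with isotropic direction. *)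
Lemma eichler_split x y v : bil x x = 0 -> bil y y = 0 -> bil x y = 0 ->
    bil x v = 0 -> bil y v = 0 ->
  eichler (x + y) v = eichler x v *m eichler y v *m eichler x (qf v *: y).
Proof.
move=> xx yy xy xv yv; apply: mx_ext => w; rewrite -!mulmxA !eichlerE !(bilE, qfZ).
rewrite (bilC v x) (bilC v y) (bilC y x) xx yy xy xv yv (bil_qf v).
have -> : qf y = 0 by rewrite /qf yy mulr0.
apply/matrixP=> i j; rewrite !mxE; ring.
Qed.

Lemma eichler_swap x y : bil x x = 0 -> bil y y = 0 ->
  eichler x y = eichler y (- x).
Proof.
move=> xx yy; apply: mx_ext => w; rewrite !eichlerE /qf !bilE xx yy.
apply/matrixP=> i j; rewrite !mxE; ring.
Qed.

Definition orth g := g^T *m phi *m g = phi.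

Lemma bil_orth g x y : orth g -> bil (g *m x) (g *m y) = bil x y.
Proof. by move=> Og; rewrite /bil -[in RHS]Og trmx_mul !mulmxA. Qed.

Lemma eichler_conj g u v : orth g ->
  g *m eichler u v = eichler (g *m u) (g *m v) *m g.
Proof.
move=> Og; apply: mx_ext => x; rewrite -!mulmxA !eichlerE /qf !bil_orth //.
by rewrite !(mulmxBr, mulmxDr) -!scalemxAr.
Qed.

(** Orthogonality is tested on all pairs of vectors, where it is a polynomial
identity in the values of the form. *)
Lemma eichler_orth u v : bil u u = 0 -> bil u v = 0 -> orth (eichler u v).
Proof.
move=> uu uv; rewrite /orth; apply: mx_ext => x.
suff H y : (y^T *m ((eichler u v)^T *m phi *m eichler u v *m x)) 0 0
           = (y^T *m (phi *m x)) 0 0.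
  apply/matrixP=> i j; rewrite (ord1 j).
  by have := H (delta_mx i 0); rewrite trmx_delta -!rowE !mxE.
transitivity (bil (eichler u v *m y) (eichler u v *m x)).
  by rewrite /bil trmx_mul !mulmxA.
transitivity (bil y x); last by rewrite /bil mulmxA.
rewrite !eichlerE !bilE uu (bilC v u) uv !(bilC y) (bil_qf v); ring.
Qed.

Lemma orthM g k : orth g -> orth k -> orth (g *m k).
Proof. by move=> Og Ok; rewrite /orth trmx_mul -[RHS]Ok -[in RHS]Og !mulmxA. Qed.

Lemma orth1 : orth 1%:M.
Proof. by rewrite /orth trmx1 mul1mx mulmx1. Qed.

End Eichler.

(** * The elementary subgroup in terms of Eichler transvections *)

(* The product of matrices as a monoid law, so that words are big operators. *)
HB.instance Definition _ (A : pzRingType) n :=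
  Monoid.isLaw.Build 'M[A]_n 1%:M mulmx (@mulmxA A n n n n) (@mul1mx A n n)
    (@mulmx1 A n n).

Section HyperbolicIndices.
Variable m : nat.

(** With indices starting from 0, the hyperbolic planes are spanned by the pairs of
indices (0, 1), (2, 3), and so on; [bar] exchanges the two indices of a plane. *)
Definition barn p := if odd p then p.-1 else p.+1.

Fact bar_subproof (p : 'I_(2 * m)) : (barn p < 2 * m)%N.
Proof. by case: p => p /= pm; rewrite /barn; case: ifP => op; lia. Qed.

Definition bar (p : 'I_(2 * m)) : 'I_(2 * m) := Ordinal (bar_subproof p).

Lemma barK : involutive bar.
Proof.
move=> p; apply: val_inj; rewrite /= /barn.
by case: (boolP (odd p)) => op; case: ifP => op'; lia.
Qed.

Lemma bar_neq p : bar p != p.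
Proof. by rewrite -val_eqE /= /barn; case: ifP => op; lia. Qed.

Lemma bar_inj : injective bar. Proof. exact: inv_inj barK. Qed.

Lemma bar_eq p q : (bar p == q) = (p == bar q).
Proof. exact: (inv_eq barK). Qed.

Lemma other_plane p : (1 < m)%N -> exists q, (q != p) && (q != bar p).
Proof.
move=> m1; case: (ltnP p 2) => p2.
  have q_lt : (2 < 2 * m)%N by lia.
  by exists (Ordinal q_lt); rewrite -!val_eqE /= /barn; case: ifP => op; lia.
have q_lt : (0 < 2 * m)%N by lia.
by exists (Ordinal q_lt); rewrite -!val_eqE /= /barn; case: ifP => op; lia.
Qed.

End HyperbolicIndices.

Section Basis.
Variables (A : comNzRingType) (m : nat).
Local Notation n := (2 * m).+1.
Local Notation phi := (phi_odd A m).
Local Notation "'B'" := (bil phi).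
Implicit Types (p q : 'I_(2 * m)) (u v x y : 'cV[A]_n).

(** In the 1-based numbering of the matrix units, o is the basis vector e_1 and
h p is e_{p+2}. *)
Definition ov : 'cV[A]_n := delta_mx 0 0.
Definition hv p : 'cV[A]_n := delta_mx (lift ord0 p) 0.
Local Notation o := ov.
Local Notation h := hv.

Lemma phi_oo : phi 0 0 = 2%:R.
Proof.
rewrite phi_oddE mxE summxE big_nat big1 ?addr0 ?mxE /= ?mulr1 // => i /andP[i1 _].
rewrite !mxE /=.
have [-> ->] : (1 == 2 * i)%N = false /\ (1 == (2 * i).+1)%N = false by lia.
by rewrite addr0.
Qed.

Lemma phi_oh p : phi 0 (lift ord0 p) = 0.
Proof.
rewrite phi_oddE mxE summxE big_nat big1 ?addr0 ?mxE /= ?mulr0 // => i /andP[i1 _].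
rewrite !mxE /=.
have [-> ->] : (1 == 2 * i)%N = false /\ (1 == (2 * i).+1)%N = false by lia.
by rewrite addr0.
Qed.

Lemma phi_hh p q : phi (lift ord0 p) (lift ord0 q) = (q == bar p)%:R.
Proof.
have pm := ltn_ord p; have qm := ltn_ord q.
rewrite phi_oddE mxE summxE (bigD1_seq (p./2).+1) ?iota_uniq //=; last first.
  by rewrite mem_index_iota; lia.
rewrite big_nat_cond big1 => [|i /andP[/andP[i1 _] ip]].
  rewrite !mxE /= /bump /= !add1n mulr0 add0r addr0 -val_eqE /= /barn.
  have [op|ep] := boolP (odd p).
    have -> : (p.+2 == 2 * p./2.+1)%N = false by lia.
    have -> : (p.+2 == (2 * p./2.+1).+1)%N by lia.
    by rewrite add0r; congr (_%:R); lia.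
  have -> : (p.+2 == 2 * p./2.+1)%N by lia.
  have -> : (p.+2 == (2 * p./2.+1).+1)%N = false by lia.
  by rewrite addr0; congr (_%:R); lia.
rewrite !mxE /= /bump /= !add1n.
have -> : (p.+2 == 2 * i)%N = false by lia.
have -> : (p.+2 == (2 * i).+1)%N = false by lia.
by rewrite addr0.
Qed.

Lemma phi_sym : phi^T = phi.
Proof.
have tr_e k l : (munit n A k l)^T = munit n A l k.
  by apply/matrixP=> i j; rewrite !mxE andbC.
rewrite phi_oddE linearD linearZ /= tr_e linear_sum; congr (_ + _).
by apply: eq_bigr => i _; rewrite linearD /= !tr_e addrC.
Qed.

Lemma phi_ho p : phi (lift ord0 p) 0 = 0.
Proof. by rewrite -phi_sym mxE phi_oh. Qed.

Lemma bil_delta i j : B (delta_mx i 0) (delta_mx j 0) = phi i j.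
Proof. by rewrite /bil trmx_delta -rowE -colE !mxE. Qed.

Lemma bil_oo : B o o = 2%:R. Proof. by rewrite bil_delta phi_oo. Qed.
Lemma bil_oh p : B o (h p) = 0. Proof. by rewrite bil_delta phi_oh. Qed.
Lemma bil_ho p : B (h p) o = 0. Proof. by rewrite bil_delta phi_ho. Qed.
Lemma bil_hh p q : B (h p) (h q) = (q == bar p)%:R.
Proof. by rewrite bil_delta phi_hh. Qed.

Lemma cv_expand v : v = v 0 0 *: o + \sum_p v (lift ord0 p) 0 *: h p.
Proof.
rewrite -[LHS]mul1mx; apply/matrixP=> i j; rewrite (ord1 j) mul1mx !mxE summxE.
case: (unliftP ord0 i) => [p ->|->].
  rewrite (bigD1 p) //= !mxE !eqxx mulr1 big1 ?addr0 ?mulr0 ?add0r // => q qp.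
  by rewrite !mxE (inj_eq (@lift_inj _ ord0)) eq_sym (negPf qp) mulr0.
by rewrite eqxx mulr1 big1 ?addr0 // => q _; rewrite !mxE mulr0.
Qed.

Lemma bil_o v : B o v = 2%:R * v 0 0.
Proof.
rewrite {1}(cv_expand v) bilDr bilZr bil_oo bil_sumr big1 ?addr0 1?mulrC //.
by move=> p _; rewrite bilZr bil_oh mulr0.
Qed.

Lemma bil_h p v : B (h p) v = v (lift ord0 (bar p)) 0.
Proof.
rewrite {1}(cv_expand v) bilDr bilZr bil_ho mulr0 add0r bil_sumr (bigD1 (bar p)) //=.
rewrite bilZr bil_hh eqxx mulr1 big1 ?addr0 // => q qp.
by rewrite bilZr bil_hh (negPf qp) mulr0.
Qed.

(** The coordinate of u along h p is its product with the dual vector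
h (bar p). *)
Lemma bil_expand u x :
  B u x = u 0 0 * B o x + \sum_q B (h (bar q)) u * B (h q) x.
Proof.
rewrite {1}[u]cv_expand bilDl ?bilZl ?(bilC _ (\sum_q _)) ?bil_sumr //;
  try exact: phi_sym.
congr (_ + _); apply: eq_bigr => q _; rewrite bilZr bil_h barK bilC //.
exact: phi_sym.
Qed.

Lemma cv_eq u v : u 0 0 = v 0 0 -> (forall p, B (h p) u = B (h p) v) -> u = v.
Proof.
move=> uv0 uvh; rewrite (cv_expand u) (cv_expand v) uv0; congr (_ + _).
by apply: eq_bigr => p _; rewrite -[p]barK -!bil_h uvh.
Qed.

End Basis.

#[global] Hint Resolve phi_sym : core.

Arguments ov {A m}.
Arguments hv {A m} p.

Section Words.
Variables (A : comNzRingType) (m : nat) (hf : A).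
Hypothesis hf2 : 2%:R * hf = 1.
Local Notation n := (2 * m).+1.
Local Notation phi := (phi_odd A m).
Local Notation "'B'" := (bil phi).
Local Notation "'E'" := (eichler phi hf).
Local Notation o := (@ov A m).
Local Notation h := (@hv A m).
Local Notation O := (@orth A n phi).
Implicit Types (p q : 'I_(2 * m)) (u v x y : 'cV[A]_n) (M N g : 'M[A]_n).
Implicit Types (a b c z : A).

Definition gen_mx (s : 'I_(2 * m) * A) : 'M[A]_n := E (h s.1) (s.2 *: o).

Definition word_mx (w : seq ('I_(2 * m) * A)) : 'M[A]_n :=
  \big[mulmx/1%:M]_(s <- w) gen_mx s.

(** Words rather than the generated subgroup: words can be mapped along ring
morphisms and their coefficients can be split into constant and nonconstant
parts. *)
Definition elementary M := exists w, M = word_mx w.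

Lemma elementary1 : elementary 1%:M.
Proof. by exists [::]; rewrite /word_mx big_nil. Qed.

Lemma elementaryM M N : elementary M -> elementary N -> elementary (M *m N).
Proof. by move=> [v ->] [w ->]; exists (v ++ w); rewrite /word_mx big_cat. Qed.

Lemma elementary_gen p c : elementary (E (h p) (c *: o)).
Proof. by exists [:: (p, c)]; rewrite /word_mx big_seq1. Qed.

Lemma bil_hh0 p : B (h p) (h p) = 0.
Proof. by rewrite bil_hh eq_sym (negPf (bar_neq p)). Qed.

Lemma gen_mxN p c : gen_mx (p, c) *m gen_mx (p, - c) = 1%:M.
Proof.
rewrite /gen_mx /= scaleNr eichlerN ?bil_hh0 ?bilZr ?bil_ho ?mulr0 //.
Qed.

Lemma elementary_inv M N : elementary M -> M *m N = 1%:M -> elementary N.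
Proof.
case=> w -> {M}; elim: w N => [|[p c] w IHw] N.
  by rewrite /word_mx big_nil mul1mx => ->; apply: elementary1.
rewrite /word_mx big_cons -/(word_mx w) => MN.
have {}MN : word_mx w *m (N *m gen_mx (p, c)) = 1%:M.
  have NC : gen_mx (p, - c) *m gen_mx (p, c) = 1%:M.
    by have := gen_mxN p (- c); rewrite opprK.
  rewrite mulmxA -NC; congr (_ *m _).
  by rewrite -[RHS]mulmx1 -MN !mulmxA NC mul1mx.
have -> : N = (N *m gen_mx (p, c)) *m gen_mx (p, - c).
  by rewrite -mulmxA gen_mxN mulmx1.
by apply: elementaryM; [apply: IHw | apply: elementary_gen].
Qed.

Lemma elementary_has_inv M : elementary M ->
  exists2 N, elementary N & M *m N = 1%:M /\ N *m M = 1%:M.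
Proof.
case=> w -> {M}; elim: w => [|[p c] w [N ElN [wN Nw]]].
  by exists 1%:M; [apply: elementary1 | rewrite /word_mx big_nil mul1mx].
exists (N *m gen_mx (p, - c)); first by apply: elementaryM => //; apply: elementary_gen.
rewrite /word_mx big_cons -/(word_mx w); split.
  by rewrite -mulmxA (mulmxA (word_mx w)) wN mul1mx gen_mxN.
have := gen_mxN p (- c); rewrite opprK => E1.
by rewrite -mulmxA (mulmxA (gen_mx (p, - c))) E1 mul1mx Nw.
Qed.

Lemma elementary_orth M : elementary M -> O M.
Proof.
case=> w ->; rewrite /word_mx; elim/big_rec: _ => [|[p c] N _ ON]; first exact: orth1.
apply: orthM => //; apply: eichler_orth => //; first exact: bil_hh0.
by rewrite bilZr bil_ho mulr0.
Qed.

Lemma elementary_conj g u v : elementary g -> elementary (E u v) ->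
  elementary (E (g *m u) (g *m v)).
Proof.
move=> Elg Eluv; have [k Elk [gk _]] := elementary_has_inv Elg.
have -> : E (g *m u) (g *m v) = g *m E u v *m k.
  by rewrite eichler_conj -?mulmxA ?gk ?mulmx1 //; exact: elementary_orth.
by apply: elementaryM => //; apply: elementaryM.
Qed.

Lemma munit_hh p q : munit n A p.+2 q.+2 = h p *m (h q)^T.
Proof.
apply/matrixP=> i j; rewrite !mxE big_ord1 !mxE !eqxx !andbT -natrM mulnb.
by rewrite -!val_eqE /= /bump /= !add1n !eqSS.
Qed.

Lemma munit_oh q : munit n A 1 q.+2 = o *m (h q)^T.
Proof.
apply/matrixP=> i j; rewrite !mxE big_ord1 !mxE !eqxx !andbT -natrM mulnb.
by rewrite -!val_eqE /= /bump /= !add1n !eqSS.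
Qed.

Lemma munit_ho p : munit n A p.+2 1 = h p *m o^T.
Proof.
apply/matrixP=> i j; rewrite !mxE big_ord1 !mxE !eqxx !andbT -natrM mulnb.
by rewrite -!val_eqE /= /bump /= !add1n !eqSS.
Qed.

Lemma tr_h_phi p : (h p)^T *m phi = (h (bar p))^T.
Proof.
apply/matrixP=> i j; rewrite (ord1 i) !mxE eqxx andbT.
have := bil_h p (delta_mx j 0 : 'cV[A]_n); rewrite /bil -colE !mxE => ->.
by rewrite eqxx andbT eq_sym.
Qed.

Lemma tr_o_phi : o^T *m phi = 2%:R *: o^T.
Proof.
apply/matrixP=> i j; rewrite (ord1 i) !mxE eqxx andbT.
have := bil_o (delta_mx j 0 : 'cV[A]_n); rewrite /bil -colE !mxE => ->.
by rewrite eqxx andbT eq_sym.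
Qed.

(** The two families F1 and F2 are the transvections along the two vectors of each
hyperbolic plane. *)
Lemma gen_mxE p z : gen_mx (p, - z) =
  1%:M + z *: munit n A 1 (bar p).+2 - (2%:R * z) *: munit n A p.+2 1
     - (z ^+ 2) *: munit n A p.+2 (bar p).+2.
Proof.
rewrite munit_hh munit_oh munit_ho /gen_mx /eichler /= qfZ //.
have -> : qf phi hf o = 1 by rewrite /qf bil_oo mulrC.
rewrite -!mulmxA [(_ *: o)^T]linearZ /= -!scalemxAl tr_h_phi tr_o_phi.
rewrite -!scalemxAr scalerA mulr1 sqrrN !scaleNr opprK mulNr scaleNr.
rewrite [z * 2%:R]mulrC; congr (_ - _); exact: addrAC.
Qed.

Lemma EO_genP (g : GL n A) :
  EO_generators g <-> exists s, GLmx g = gen_mx s.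
Proof.
split=> [[i [z [ir gF]]]|[[p c] gE]].
  have i_even : ((2 * i).-2 < 2 * m)%N by lia.
  have i_odd : ((2 * i).-1 < 2 * m)%N by lia.
  case: gF => ->.
    exists (Ordinal i_even, - z); rewrite gen_mxE /F1mx /= /barn.
    have -> : odd (2 * i).-2 = false by lia.
    by have -> : (2 * i).-2.+2 = (2 * i)%N by lia.
  exists (Ordinal i_odd, - z); rewrite gen_mxE /F2mx /= /barn.
  have -> : odd (2 * i).-1 by lia.
  have -> : (2 * i).-1.+2 = (2 * i).+1 by lia.
  by have -> : (2 * i).-1.-1.+2 = (2 * i)%N by lia.
have pm := ltn_ord p; rewrite /EO_generators /= gE -[c]opprK gen_mxE /= /barn.
have [op|ep] := boolP (odd p).
  exists (p.+1)./2, (- c); split; first by lia.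
  right; rewrite /F2mx.
  have -> : (2 * (p.+1)./2)%N = p.-1.+2 by lia.
  by have -> : p.-1.+3 = p.+2 by lia.
exists (p./2.+1), (- c); split; first by lia.
by left; rewrite /F1mx; have -> : (2 * p./2.+1)%N = p.+2 by lia.
Qed.

Lemma GL_lift M N : M *m N = 1%:M -> N *m M = 1%:M ->
  exists g : GL n A, GLmx g = M.
Proof.
move=> MN NM; have inv : is_inverse_pair (M, N).
  by rewrite /is_inverse_pair /= MN NM !eqxx.
by exists (MkGL inv).
Qed.

Lemma EO_subgroup : subgroup (EO_odd A m).
Proof.
split=> [H [[H1 _ _] _]//|x y Ex Ey H [sH genH]|x Ex H [sH genH]].
  by case: (sH) => _ HM _; apply: HM; [apply: Ex | apply: Ey].
by case: (sH) => _ _ HV; apply: HV; apply: Ex.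
Qed.

Lemma EO_elementaryP (g : GL n A) : EO_odd A m g <-> elementary (GLmx g).
Proof.
split=> [|[w]].
  pose H : set (GL n A) := [set k | elementary (GLmx k)]%classic.
  suff: (EO_odd A m `<=` H)%classic by apply.
  apply: smallest_sub => [|k /EO_genP[s ks]]; last first.
    by exists [:: s]; rewrite /word_mx big_seq1.
  split=> [|x y Ex Ey|x Ex]; first exact: elementary1.
    exact: (elementaryM Ex Ey).
  apply: (elementary_inv Ex); change (GLmx (x * x^-1)%g = 1%:M).
  by rewrite mulgV.
elim: w g => [|s w IHw] g.
  rewrite /word_mx big_nil => g1; have -> : g = 1%g by apply: GLmx_inj.
  by have [] := EO_subgroup.
rewrite /word_mx big_cons -/(word_mx w) => gE.
have [k kE] : exists k : GL n A, GLmx k = gen_mx s.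
  case: s {gE} => p c; apply: (@GL_lift _ (gen_mx (p, - c))); first exact: gen_mxN.
  by have := gen_mxN p (- c); rewrite opprK.
have -> : g = (k * (k^-1 * g))%g by rewrite mulgA mulgV mul1g.
have [_ EM _] := EO_subgroup; apply: EM.
  by apply: sub_gen_smallest; apply/EO_genP; exists s.
apply: IHw; change (GLmx (k^-1)%g *m GLmx g = word_mx w); rewrite gE -kE mulmxA.
change (GLmx (k^-1 * k)%g *m word_mx w = word_mx w).
by rewrite mulVg mul1mx.
Qed.

End Words.

(** * Which Eichler transvections are elementary *)

Section ElementaryEichler.
Variables (A : comNzRingType) (m : nat) (hf : A).
Hypothesis hf2 : 2%:R * hf = 1.
Local Notation n := (2 * m).+1.
Local Notation phi := (phi_odd A m).
Local Notation "'B'" := (bil phi).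
Local Notation "'E'" := (eichler phi hf).
Local Notation o := (@ov A m).
Local Notation h := (@hv A m).
Local Notation elementary := (@elementary A m hf).
Implicit Types (p q : 'I_(2 * m)) (u v w x y : 'cV[A]_n) (M N g : 'M[A]_n).
Implicit Types (a b c z : A).

Lemma elementary_eichlerD u v w : B u u = 0 -> B u v = 0 -> B u w = 0 ->
  elementary (E u v) -> elementary (E u w) -> elementary (E u (v + w)).
Proof. by move=> uu uv uw Ev Ew; rewrite eichlerD //; apply: elementaryM. Qed.

Lemma elementary_eichler_sum u (I : finType) (P : pred I) (F : I -> 'cV[A]_n) :
    B u u = 0 -> (forall i, P i -> B u (F i) = 0) ->
    (forall i, P i -> elementary (E u (F i))) ->
  elementary (E u (\sum_(i | P i) F i)).
Proof.
move=> uu uF EF.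
suff [] : B u (\sum_(i | P i) F i) = 0 /\
    elementary (E u (\sum_(i | P i) F i)) by [].
elim/big_rec: _ => [|i v Pi [uv Ev]].
  by rewrite bil0r eichler0; split=> //; apply: elementary1.
rewrite bilDr uF // uv addr0; split=> //.
by apply: elementary_eichlerD; rewrite ?uF //; apply: EF.
Qed.

(** The transvection E(x, o / 2) sends o to o + x and fixes y; comparing
E(y, c o) with its conjugate leaves E(y, c x), which is E(x, - c y).  This is
where 2 has to be invertible. *)
Lemma elementary_eichler_iso x y : B x x = 0 -> B y y = 0 -> B x y = 0 ->
    B x o = 0 -> B y o = 0 ->
    (forall c, elementary (E x (c *: o))) -> (forall c, elementary (E y (c *: o))) ->
  forall c, elementary (E x (c *: y)).
Proof.
move=> xx yy xy xo yo Ex Ey c.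
have xo0 a : B x (a *: o) = 0 by rewrite bilZr xo mulr0.
have yo0 a : B y (a *: o) = 0 by rewrite bilZr yo mulr0.
have yx a : B y (a *: x) = 0 by rewrite bilZr bilC // xy mulr0.
have ky : E x (hf *: o) *m y = y.
  by rewrite eichlerE bilZl // (bilC _ o) // yo xy !(mulr0, scale0r, subr0, addr0).
have ko : E x (hf *: o) *m (- c *: o) = - c *: o + - c *: x.
  rewrite eichlerE !(bilZl, bilZr) // bil_oo xo !(mulr0, scale0r, subr0).
  by congr (_ + _ *: _); rewrite (mulrC hf) -mulrA hf2 mulr1.
have := elementary_conj hf2 (Ex hf) (Ey (- c)); rewrite ky ko => H.
suff -> : E x (c *: y) = E y (- c *: o + - c *: x) *m E y (c *: o).
  by apply: elementaryM; last exact: Ey.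
have -> : E x (c *: y) = E y (- c *: x).
  rewrite [RHS]eichler_swap ?eichlerZ ?scaleNr ?scalerN ?opprK //.
  by rewrite !(bilNl, bilNr, bilZl, bilZr) // xx !(mulr0, oppr0).
rewrite -eichlerD ?bilDr ?yx ?yo0 ?addr0 //.
by rewrite addrAC -scalerDl addNr scale0r add0r.
Qed.

Lemma eichler_fix u v x : B u x = 0 -> B v x = 0 -> E u v *m x = x.
Proof. by move=> ux vx; rewrite eichlerE ux vx mulr0 !scale0r !subr0 addr0. Qed.

Lemma elementary_hv p v : B (h p) v = 0 -> elementary (E (h p) v).
Proof.
move=> pv; have pp : B (h p) (h p) = 0 := bil_hh0 A p.
rewrite [v]cv_expand; apply: elementary_eichlerD => //.
- by rewrite bilZr bil_ho mulr0.
- rewrite bil_sumr (bigD1 (bar p)) //= bilZr -bil_h pv mul0r add0r big1 // => q.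
  by rewrite bilZr bil_hh => /negPf->; rewrite mulr0.
- exact: elementary_gen.
apply: elementary_eichler_sum => // q _.
  rewrite bilZr bil_hh; case: eqP => [->|_]; last by rewrite mulr0.
  by rewrite -bil_h pv mul0r.
have [->|qp'] := eqVneq q (bar p).
  by rewrite -bil_h pv scale0r eichler0; apply: elementary1.
have [->|qp] := eqVneq q p; first by rewrite eichlerS //; apply: elementary1.
apply: elementary_eichler_iso => //; rewrite ?bil_hh0 ?bil_ho //.
- by rewrite bil_hh (negPf qp').
- exact: elementary_gen.
- exact: elementary_gen.
Qed.

Lemma elementary_hv2 p q a b v : q != bar p -> B (h p) v = 0 -> B (h q) v = 0 ->
  elementary (E (a *: h q + b *: h p) v).
Proof.
move=> qp pv qv; have qpb : B (h q) (h p) = 0.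
  by rewrite bil_hh -bar_eq eq_sym (negPf qp).
rewrite eichler_split ?(bilZl, bilZr) // ?bil_hh0 ?qpb ?pv ?qv ?mulr0 //.
rewrite !eichlerZ //; apply: elementaryM; first apply: elementaryM; apply: elementary_hv;
  by rewrite !bilZr ?pv ?qv ?qpb ?mulr0.
Qed.

(** The vector k below is isotropic, so E(u, k) = E(k, - u) and u may be split
into components orthogonal to k.  Only y, the component of u in the plane dual
to that of k, needs an argument: both k and y are isotropic and orthogonal to
o, and [elementary_eichler_iso] applies to them. *)
Lemma elementary_koszul_hh u p q z : B u u = 0 -> q != bar p -> q != p ->
  elementary (E u (z *: (B (h p) u *: h q - B (h q) u *: h p))).
Proof.
move=> uu qp qp'; set a := B (h p) u; set b := B (h q) u.
set k := a *: h q - b *: h p; set y := a *: h (bar p) + b *: h (bar q).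
have Bhh r s : B (h r) (h s) = (s == bar r)%:R := bil_hh A r s.
have qpf : (q == bar p) = false := negbTE qp.
have pqf : (p == bar q) = false by rewrite -bar_eq eq_sym.
have qpf' : (q == p) = false := negbTE qp'.
have pqf' : (p == q) = false by rewrite eq_sym.
have hyp : B (h p) y = a.
  by rewrite !bilE // !Bhh eqxx (inj_eq (@bar_inj m)) qpf' mulr1 mulr0 addr0.
have hyq : B (h q) y = b.
  by rewrite !bilE // !Bhh eqxx (inj_eq (@bar_inj m)) pqf' mulr1 mulr0 add0r.
have kk : B k k = 0.
  by rewrite !bilE // !bil_hh0 !Bhh qpf pqf !(mulr0, oppr0, addr0).
have ky : B k y = 0 by rewrite bilDl ?bilNl ?bilZl // hyp hyq mulrC subrr.
have ku : B k u = 0 by rewrite bilDl ?bilNl ?bilZl // -/a -/b mulrC subrr.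
have yy : B y y = 0.
  rewrite !bilE // !bil_hh0 !Bhh !(inj_eq (@bar_inj m)).
  by rewrite qpf pqf !(mulr0, oppr0, addr0).
have ko : B k o = 0 by rewrite !bilE // !bil_ho !(mulr0, oppr0, addr0).
have yo : B y o = 0 by rewrite !bilE // !bil_ho !(mulr0, oppr0, addr0).
have kE c v : B (h p) v = 0 -> B (h q) v = 0 -> elementary (E k (c *: v)).
  move=> pv qv; rewrite /k -scaleNr; apply: elementary_hv2 => //.
    by rewrite bilZr pv mulr0.
  by rewrite bilZr qv mulr0.
rewrite eichler_swap ?bilZl ?bilZr // ?kk ?mulr0 // eichlerZ // -(subrK y u).
rewrite opprD scalerDr; apply: elementary_eichlerD => //.
- by rewrite bilZr bilNr bilDr bilNr ku ky subrr oppr0 mulr0.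
- by rewrite bilZr bilNr ky oppr0 mulr0.
- rewrite scalerN -scaleNr; apply: kE; rewrite bilDr bilNr ?hyp ?hyq -/a -/b; exact: subrr.
rewrite scalerN -scaleNr; apply: elementary_eichler_iso => // c.
  by apply: kE; apply: bil_ho.
rewrite /y addrC; apply: elementary_hv2; rewrite ?bilZr ?bil_ho ?mulr0 //.
by rewrite (inj_eq (@bar_inj m)).
Qed.

(** The vector v below is not isotropic, so the roles of u and v cannot be
exchanged.  Instead E(u, a^2 v) is found inside a conjugate: a second hyperbolic
plane provides isotropic vectors k and k' orthogonal to u and v with
B(k, k') = a^2; then E(u, k) sends k' to k' + a^2 u and fixes v, and
[eichler_split] isolates E(a^2 u, v). *)
Lemma elementary_koszul_ho u p z : (1 < m)%N -> B u u = 0 ->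
  elementary (E u ((B (h p) u ^+ 2 * z) *: (B (h p) u *: o - B o u *: h p))).
Proof.
move=> m1 uu; have [q /andP[qp qpb]] := other_plane p m1.
set a := B (h p) u; set b := B (h q) u; set b' := B (h (bar q)) u.
set v := _ - _.
have Bhh r s : B (h r) (h s) = (s == bar r)%:R := bil_hh A r s.
have qpf : (q == bar p) = false := negbTE qpb.
have pqf : (p == bar q) = false by rewrite -bar_eq eq_sym.
have qpf' : (q == p) = false := negbTE qp.
have pqf' : (p == q) = false by rewrite eq_sym.
have pbqb : (bar p == bar q) = false by rewrite (inj_eq (@bar_inj m)) pqf'.
have qbpb : (bar q == bar p) = false by rewrite (inj_eq (@bar_inj m)) qpf'.
have qbp : (bar q == p) = false by rewrite eq_sym.
set k := a *: h q - b *: h p; set k' := a *: h (bar q) - b' *: h p.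
have ku : B u k = 0 by rewrite !bilE // !(bilC _ u) // -/a -/b mulrC subrr.
have k'u : B u k' = 0 by rewrite !bilE // !(bilC _ u) // -/a -/b' mulrC subrr.
have vu : B u v = 0 by rewrite !bilE // !(bilC _ u) // -/a mulrC subrr.
have hpv : B (h p) v = 0 by rewrite !bilE // bil_ho bil_hh0 !mulr0 subrr.
have hqv : B (h q) v = 0 by rewrite !bilE // bil_ho Bhh pqf !mulr0 subrr.
have hqbv : B (h (bar q)) v = 0 by rewrite !bilE // bil_ho Bhh barK pqf' !mulr0 subrr.
have kv : B k v = 0 by rewrite bilDl ?bilNl ?bilZl // hpv hqv !mulr0 subrr.
have k'v : B k' v = 0 by rewrite bilDl ?bilNl ?bilZl // hpv hqbv !mulr0 subrr.
have kk' : B k k' = a ^+ 2.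
  by rewrite !bilE // !bil_hh0 !Bhh eqxx pqf qbpb; rewrite ?(mulr1n, mulr0n); ring.
have k'k' : B k' k' = 0.
  by rewrite !bilE // !bil_hh0 !Bhh barK pqf' qbpb; rewrite ?(mulr1n, mulr0n); ring.
have kk : B k k = 0.
  by rewrite !bilE // !bil_hh0 !Bhh pqf qpf ?(mulr1n, mulr0n); ring.
have Ek : elementary (E u k) by rewrite -[k]scale1r; apply: elementary_koszul_hh.
have Ek' c : elementary (E k' (c *: v)).
  rewrite /k' -scaleNr; apply: elementary_hv2; rewrite ?bilZr ?hpv ?hqbv ?mulr0 //.
  by rewrite qbpb.
have := elementary_conj hf2 Ek (Ek' z).
have -> : E u k *m k' = k' + a ^+ 2 *: u.
  by rewrite eichlerE kk' k'u mulr0 !scale0r !subr0.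
have -> : E u k *m (z *: v) = z *: v.
  by apply: eichler_fix; rewrite bilZr ?kv ?vu mulr0.
have k'u' : B k' u = 0 by rewrite bilC.
rewrite eichler_split ?(bilZl, bilZr) // ?uu ?vu ?k'v ?k'u' ?k'k' ?mulr0 //.
rewrite scalerA -[E k' (_ *: u)]eichlerZ // [E (_ *: u) _]eichlerZ // scalerA.
set c := qf _ _ _ * _ => H.
have [N ElN [_ kN]] := elementary_has_inv hf2 (Ek' z).
have Elast : elementary (E (c *: k') u).
  rewrite eichler_swap ?bilZl ?bilZr ?k'k' ?mulr0 // -scaleNr.
  by apply: elementary_koszul_hh; rewrite // ?qbpb ?qbp.
have [L ElL [kL _]] := elementary_has_inv hf2 Elast.
have := elementaryM (elementaryM ElN H) ElL; rewrite -!mulmxA kL mulmx1 mulmxA kN mul1mx.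
by [].
Qed.

(** Modulo u, the vector a v may be replaced by a vector w with no component along
the vector dual to h p.  As w is orthogonal to u, a w = K(w) is the combination
of the Koszul vectors K(e) = a e - B(e, u) h p with the coordinates of w.  One
factor a is used to pass to w, one to pass to Koszul vectors, and two by
[elementary_koszul_ho]. *)
Lemma elementary_eichler_pow u v p z : (1 < m)%N -> B u u = 0 -> B u v = 0 ->
  elementary (E u ((B (h p) u ^+ 4 * z) *: v)).
Proof.
move=> m1 uu uv; set a := B (h p) u.
set b := B (h p) v; pose w := a *: v - b *: u.
have hpw : B (h p) w = 0 by rewrite !bilE // -/a -/b mulrC subrr.
have uw : B u w = 0 by rewrite !bilE // uu uv !mulr0 subrr.
pose K x := a *: x - B x u *: h p.
have uK x : B u (K x) = 0.
  by rewrite !bilE // (bilC _ u x) // (bilC _ u (h p)) // -/a mulrC subrr.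
have awE : a *: w = w 0 0 *: K o + \sum_q w (lift ord0 q) 0 *: K (h q).
  have -> : a *: w = K w by rewrite /K (bilC _ w) // uw scale0r subr0.
  have KD x y : K (x + y) = K x + K y.
    by rewrite /K bilDl // scalerDr scalerDl opprD addrACA.
  have KZ c x : K (c *: x) = c *: K x.
    by rewrite /K bilZl // scalerBr !scalerA (mulrC a).
  rewrite [w in K w]cv_expand KD KZ; congr (_ + _).
  by apply: (big_ind2 (fun x y => K x = y)) => [|x _ y _ <- <-|q _];
    rewrite ?KD ?KZ // -[0](scale0r 0) KZ !scale0r.
have -> : (a ^+ 4 * z) *: v = (a ^+ 2 * z) *: (a *: w) + (a ^+ 3 * z * b) *: u.
  rewrite /w; apply/matrixP=> i j; rewrite !mxE; ring.
apply: elementary_eichlerD; rewrite ?bilZr ?uu ?uw ?mulr0 //; last first.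
  by rewrite eichlerS //; apply: elementary1.
rewrite awE scalerDr; apply: elementary_eichlerD; rewrite ?bilZr ?uK ?mulr0 //.
- by rewrite bil_sumr big1 ?mulr0 // => q _; rewrite bilZr uK mulr0.
- by rewrite scalerA -mulrA; apply: elementary_koszul_ho.
rewrite scaler_sumr; apply: elementary_eichler_sum => // q _.
  by rewrite !bilZr uK !mulr0.
have [->|qp'] := eqVneq q (bar p).
  by rewrite -bil_h hpw scale0r scaler0 eichler0; apply: elementary1.
have [->|qp] := eqVneq q p.
  by rewrite /K -/a subrr !scaler0 eichler0; apply: elementary1.
by rewrite scalerA; apply: elementary_koszul_hh.
Qed.

End ElementaryEichler.

(** * Maximal ideals *)

Section MaximalIdeals.
Variable A : comNzRingType.
Implicit Types (I J M : set A) (x y : A).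
Local Open Scope classical_set_scope.

Lemma proper_in_maximal I : ideal I -> ~ I 1 ->
  exists2 M, maximal_ideal M & I `<=` M.
Proof.
(* The empty set is added so that the union of an empty chain is allowed. *)
move=> idI I1; pose P J := [/\ ideal J, ~ J 1 & I `<=` J] \/ J = set0.
have [F FP totF|M [PM maxM]] := @Zorn_bigcup A P.
  have [[J0 FJ0 J0n]|F0] := pselect (exists2 J, F J & J <> set0); last first.
    right; apply/seteqP; split=> // x [J FJ Jx]; case: F0; exists J => // Je.
    by rewrite Je in Jx.
  have PF J x : F J -> J x -> [/\ ideal J, ~ J 1 & I `<=` J].
    by move=> FJ Jx; case: (FP _ FJ) => // Je; rewrite Je in Jx.
  have [x0 J0x0] : exists x, J0 x by apply/set0P/eqP.
  have [idJ0 J01 IJ0] := PF _ _ FJ0 J0x0.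
  left; split; first 1 last.
  - by move=> [J FJ J1]; have [_] := PF _ _ FJ J1.
  - by move=> x Ix; exists J0 => //; apply: IJ0.
  split; first by exists J0 => //; case: idJ0.
    move=> x y [J FJ Jx] [K FK Ky].
    have [[_ JD _] _ _] := PF _ _ FJ Jx; have [[_ KD _] _ _] := PF _ _ FK Ky.
    have [JK|KJ] := totF _ _ FJ FK.
      by exists K => //; apply: KD => //; apply: JK.
    by exists J => //; apply: JD => //; apply: KJ.
  move=> a x [J FJ Jx]; exists J => //.
  by have [[_ _ JZ] _ _] := PF _ _ FJ Jx; apply: JZ.
have [idM M1 IM] : [/\ ideal M, ~ M 1 & I `<=` M].
  case: PM => [//|M0]; exfalso.
  have MI : M `<` I by rewrite M0; split=> // /(_ 0); apply; case: idI.
  by apply: (maxM _ MI); left; split=> // x.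
exists M => //; split=> // [MT|J idJ MJ]; first by apply: M1; rewrite MT.
have [J1|J1] := pselect (J 1).
  right; apply/seteqP; split=> // x _; rewrite -[x]mulr1.
  by case: idJ => _ _; apply.
left; apply: contrapT => JM.
have MJ' : M `<` J by split=> // JM'; apply: JM; apply/seteqP.
by apply: (maxM _ MJ'); left; split=> //; apply: subset_trans MJ.
Qed.

(** The local-global principle for membership in an ideal. *)
Lemma ideal_has1 J : ideal J ->
  (forall M, maximal_ideal M -> exists2 x, J x & ~ M x) -> J 1.
Proof.
move=> idJ maxJ; apply: contrapT => /(proper_in_maximal idJ)[M maxM JM].
by have [x /JM] := maxJ M maxM.
Qed.

Lemma maximal_not1 M : maximal_ideal M -> ~ M 1.
Proof.
move=> [[_ _ MZ] MT _] M1; apply: MT; apply/seteqP; split=> // x _.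
by rewrite -[x]mulr1; apply: MZ.
Qed.

Lemma maximal_prime M x y : maximal_ideal M -> M (x * y) -> M x \/ M y.
Proof.
move=> [[M0 MD MZ] _ maxM] Mxy.
have [Mx|Mx] := pselect (M x); [by left | right].
pose J := [set a + x * b | a in M & b in setT].
have [JM|JT] : J = M \/ J = setT.
- apply: maxM.
    split.
    + by exists 0 => //; exists 0 => //; rewrite mulr0 addr0.
    + move=> _ _ [a Ma [b _ <-]] [c Mc [d _ <-]].
      exists (a + c); first exact: MD.
      by exists (b + d) => //; ring.
    + move=> c _ [a Ma [b _ <-]]; exists (c * a); first exact: MZ.
      by exists (c * b) => //; ring.
  by move=> a Ma; exists a => //; exists 0; rewrite ?mulr0 ?addr0.
- by case: Mx; rewrite -JM; exists 0 => //; exists 1; rewrite ?mulr1 ?add0r.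
- have [a Ma [b _ ab]] : J 1 by rewrite JT.
  have -> : y = y * a + b * (x * y) by rewrite -[LHS]mulr1 -ab; ring.
  by apply: MD; apply: MZ.
Qed.

Lemma maximal_exp M x k : maximal_ideal M -> M (x ^+ k) -> M x.
Proof.
move=> maxM; elim: k => [/maximal_not1//|k IHk].
by rewrite exprS => /(maximal_prime maxM)[].
Qed.

Lemma ideal_sum J (I : finType) (P : pred I) (F : I -> A) : ideal J ->
  (forall i, P i -> J (F i)) -> J (\sum_(i | P i) F i).
Proof. by move=> [J0 JD _] JF; elim/big_ind: _. Qed.

End MaximalIdeals.

(** * Base change *)

Section BaseChange.
Variables (A D : comNzRingType) (f : {rmorphism A -> D}) (m : nat) (hf : A).
Hypothesis hf2 : 2%:R * hf = 1.
Local Notation n := (2 * m).+1.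
Implicit Types (u v : 'cV[A]_n) (M : 'M[A]_n).

Lemma half_map : 2%:R * f hf = 1.
Proof. by rewrite -(rmorph_nat f) -rmorphM hf2 rmorph1. Qed.

Lemma map_ov : map_mx f (@ov A m) = ov.
Proof. exact: map_delta_mx. Qed.

Lemma map_hv p : map_mx f (@hv A m p) = hv p.
Proof. exact: map_delta_mx. Qed.

Lemma map_phi : map_mx f (phi_odd A m) = phi_odd D m.
Proof.
apply/matrixP=> i j; rewrite mxE.
case: (unliftP ord0 i) => [p ->|->]; case: (unliftP ord0 j) => [q ->|->].
- by rewrite !phi_hh rmorph_nat.
- by rewrite !phi_ho rmorph0.
- by rewrite !phi_oh rmorph0.
- by rewrite !phi_oo rmorph_nat.
Qed.

Lemma map_bil u v :
  f (bil (phi_odd A m) u v) = bil (phi_odd D m) (map_mx f u) (map_mx f v).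
Proof. by rewrite /bil -map_phi map_trmx -!map_mxM [RHS]mxE. Qed.

Lemma map_qf v : f (qf (phi_odd A m) hf v) = qf (phi_odd D m) (f hf) (map_mx f v).
Proof. by rewrite /qf rmorphM map_bil. Qed.

Lemma map_eichler u v : map_mx f (eichler (phi_odd A m) hf u v)
  = eichler (phi_odd D m) (f hf) (map_mx f u) (map_mx f v).
Proof.
rewrite /eichler !(map_mxB, map_mxD) map_mx1 map_mxZ !map_mxM map_qf.
by rewrite map_phi !map_trmx.
Qed.

Lemma map_gen_mx s : map_mx f (gen_mx hf s) = gen_mx (f hf) (s.1, f s.2) :> 'M_n.
Proof. by rewrite map_eichler map_hv map_mxZ map_ov. Qed.

Lemma map_word_mx w : map_mx f (@word_mx A m hf w)
  = word_mx (f hf) [seq (s.1, f s.2) | s <- w].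
Proof.
rewrite /word_mx big_map; apply: (big_ind2 (fun M N => map_mx f M = N)).
- exact: map_mx1.
- by move=> ? ? ? ? <- <-; rewrite map_mxM.
- by move=> s _; apply: map_gen_mx.
Qed.

Lemma map_elementary M : elementary hf M -> elementary (f hf) (map_mx f M).
Proof. by move=> [w ->]; rewrite map_word_mx; eexists. Qed.

Lemma map_orth M : orth (phi_odd A m) M -> orth (phi_odd D m) (map_mx f M).
Proof. by move=> OM; rewrite /orth -map_phi map_trmx -!map_mxM OM. Qed.

End BaseChange.

(** * Localizations *)

Section LocalizationMaps.
Variables (C D : comNzRingType) (S : set C) (f : {rmorphism C -> D}).

(** Rings of fractions enter only through this description, which passes from
C -> D to C[Y] -> D[Y] ([loc_poly]). *)
Record localization : Prop := Localization {
  loc1 : S 1;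
  locM : forall s t, S s -> S t -> S (s * t);
  loc_unit : forall s, S s -> invertible (f s);
  loc_frac : forall d, exists2 s, S s & exists c, f s * d = f c;
  loc_ker : forall c, f c = 0 -> exists2 s, S s & s * c = 0
}.

Hypothesis locf : localization.

(** A product over the finite index type serves as a common multiple. *)
Lemma loc_common (I : finType) (P : I -> C -> Prop) :
    (forall i s t, P i s -> P i (t * s)) ->
    (forall i, exists2 s, S s & P i s) ->
  exists2 s, S s & forall i, P i s.
Proof.
move=> PM exP; suff [s Ss Ps] : exists2 s, S s & forall i, i \in enum I -> P i s.
  by exists s => // i; apply: Ps; rewrite mem_enum.
elim: (enum I) => [|i r [s Ss Ps]]; first by exists 1 => //; apply: loc1.
have [t St Pt] := exP i; exists (t * s); first exact: locM.
move=> j; rewrite inE => /predU1P[->|jr]; first by rewrite mulrC; apply: PM.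
by apply: PM; apply: Ps.
Qed.

Lemma loc_cV n (u : 'cV[D]_n) :
  exists2 s, S s & exists U : 'cV[C]_n, map_mx f U = f s *: u.
Proof.
have [i s t [c fc]|i|s Ss Ps] :=
    @loc_common 'I_n (fun i s => exists c, f s * u i 0 = f c).
- by exists (t * c); rewrite !rmorphM -fc mulrA.
- exact: (loc_frac locf).
exists s => //; have [U UE] := choice Ps; exists (\col_i U i).
by apply/matrixP=> i j; rewrite !mxE (ord1 j) UE.
Qed.

Lemma loc_ker_mx k n (M : 'M[C]_(k, n)) : map_mx f M = 0 ->
  exists2 s, S s & s *: M = 0.
Proof.
move=> fM0; have [i s t|i|s Ss Ps] :=
    @loc_common ('I_k * 'I_n)%type (fun i s => s * M i.1 i.2 = 0).
- by move=> sM; rewrite -mulrA sM mulr0.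
- by apply: (loc_ker locf); have /matrixP/(_ i.1 i.2) := fM0; rewrite !mxE.
by exists s => //; apply/matrixP=> i j; rewrite !mxE; apply: (Ps (i, j)).
Qed.

End LocalizationMaps.

Lemma loc_id (C : comNzRingType) :
  localization [set 1]%classic (idfun : {rmorphism C -> C}).
Proof.
split=> //=; first by move=> s t -> ->; rewrite mulr1.
- by move=> s ->; exists 1; rewrite mulr1.
- by move=> d; exists 1 => //; exists d; rewrite mul1r.
- by move=> c ->; exists 1 => //; rewrite mulr0.
Qed.

Lemma loc_poly (C D : comNzRingType) (S : set C) (f : {rmorphism C -> D}) :
  localization S f -> localization [set s%:P | s in S]%classic (map_poly f).
Proof.
move=> locf; split.
- by exists 1; first exact: (loc1 locf).
- move=> _ _ [s Ss <-] [t St <-].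
  by exists (s * t); rewrite ?polyCM //; apply: (locM locf).
- move=> _ [s Ss <-]; have [y sy] := loc_unit locf Ss.
  by exists y%:P; rewrite /= map_polyC /= -polyCM sy.
- elim/poly_ind => [|p d [_ [s Ss <-] [P sP]]].
    by exists 1; [exists 1 => //; apply: (loc1 locf) | exists 0; rewrite mulr0 rmorph0].
  have [t St [c tc]] := loc_frac locf d.
  exists (s * t)%:P; first by exists (s * t) => //; apply: (locM locf).
  exists (t%:P * P * 'X + (s * c)%:P); rewrite polyCM !rmorphD !rmorphM /=.
  rewrite map_polyX -sP /= !map_polyC /= -tc !polyCM; ring.
elim/poly_ind => [|p c IHp].
  by exists 1; [exists 1 => //; apply: (loc1 locf) | rewrite mulr0].
rewrite rmorphD rmorphM /= map_polyX map_polyC /= => fp0.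
have fc0 : f c = 0.
  have := congr1 (fun q : {poly D} => q`_0) fp0.
  by rewrite coefD coefMX coefC coef0 add0r.
have fp : map_poly f p = 0.
  apply/polyP=> i; have := congr1 (fun q : {poly D} => q`_i.+1) fp0.
  by rewrite coefD coefMX coefC !coef0 /= addr0.
have [_ [s Ss <-] sp] := IHp fp; have [t St tc] := loc_ker locf fc0.
exists (s * t)%:P; first by exists (s * t) => //; apply: (locM locf).
have -> : (s * t)%:P * (p * 'X + c%:P) = t%:P * 'X * (s%:P * p) + s%:P * (t * c)%:P.
  by rewrite !polyCM; ring.
by rewrite sp tc !mulr0 addr0.
Qed.

(** * Conjugating elementary matrices *)

Section Conjugation.
Variables (C D : comNzRingType) (S : set C) (f : {rmorphism C -> D}).
Variables (m : nat) (hf : C).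
Hypotheses (locf : localization S f) (hf2 : 2%:R * hf = 1) (m1 : (1 < m)%N).
Local Notation n := (2 * m).+1.
Local Notation "'B'" := (bil (phi_odd D m)).
Local Notation "'E'" := (eichler (phi_odd D m) (f hf)).
Local Notation o := (@ov D m).
Local Notation h := (@hv D m).

Let fhf2 : 2%:R * f hf = 1 := half_map f hf2.

(** The factors d which, up to a denominator s, make E(u, d v) integral and
elementary.  They form an ideal of D, so that 1 can be reached by
[ideal_has1]. *)
Definition clears (u v : 'cV[D]_n) (d : D) :=
  exists2 s, S s & forall c, exists2 N, elementary hf N &
    map_mx f N = E u ((f (s * c) * d) *: v).

(** Lift u and v to U and W over C up to denominators, and multiply U and W by
further elements of S so that B(U, U) = 0 and B(U, W) = 0 hold already over C;
then [elementary_eichler_pow] applies over C. *)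
Lemma clears_coord (u v : 'cV[D]_n) q : B u u = 0 -> B u v = 0 ->
  clears u v (B (h q) u ^+ 4).
Proof.
move=> uu uv; have [s1 S1 [U UE]] := loc_cV locf u; have [s2 S2 [W WE]] := loc_cV locf v.
have [s3 S3 s3U] : exists2 s, S s & s * bil (phi_odd C m) U U = 0.
  by apply: (loc_ker locf); rewrite map_bil UE !(bilZl, bilZr) // uu !mulr0.
have [s4 S4 s4W] : exists2 s, S s & s * bil (phi_odd C m) U W = 0.
  by apply: (loc_ker locf); rewrite map_bil UE WE !(bilZl, bilZr) // uv !mulr0.
pose t := s1 * s2 * s3 * s4; pose r := s2 * s3 * s4.
pose U' := r *: U; pose W' := (s1 * s3 * s4) *: W.
have fU : map_mx f U' = f t *: u.
  by rewrite map_mxZ UE scalerA -rmorphM; congr (f _ *: _); rewrite /r /t; ring.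
have fW : map_mx f W' = f t *: v.
  by rewrite map_mxZ WE scalerA -rmorphM; congr (f _ *: _); rewrite /t; ring.
have U'U' : bil (phi_odd C m) U' U' = 0.
  rewrite !(bilZl, bilZr) //.
  have -> : r * (r * bil (phi_odd C m) U U)
    = s2 * s4 * r * (s3 * bil (phi_odd C m) U U) by rewrite /r; ring.
  by rewrite s3U mulr0.
have U'W' : bil (phi_odd C m) U' W' = 0.
  rewrite !(bilZl, bilZr) //.
  have -> : r * (s1 * s3 * s4 * bil (phi_odd C m) U W)
    = s2 * s3 * s1 * s3 * s4 * (s4 * bil (phi_odd C m) U W) by rewrite /r; ring.
  by rewrite s4W mulr0.
have tS : S t by rewrite /t; do !apply: (locM locf).
(* Each of the five copies of U and the copy of W contributes a factor t. *)
clearbody t; exists (t ^+ 6); first by do ?apply: (locM locf).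
move=> c.
exists (eichler (phi_odd C m) hf U' ((bil (phi_odd C m) (hv q) U' ^+ 4 * c) *: W')).
  exact: elementary_eichler_pow.
rewrite map_eichler map_mxZ fU fW eichlerZ // !scalerA; congr (E u (_ *: v)).
rewrite !(rmorphM, rmorphXn) /= map_bil map_hv fU bilZr; ring.
Qed.

Lemma clears_ideal u v : B u u = 0 -> B u v = 0 -> ideal (clears u v : set D).
Proof.
move=> uu uv; split.
- exists 1; first exact: (loc1 locf).
  move=> c; exists 1%:M; first exact: elementary1.
  by rewrite map_mx1 mulr0 scale0r eichler0.
- move=> d e [s Ss sE] [t St tE]; exists (s * t); first exact: (locM locf).
  move=> c; have [M ElM1 ME] := sE (t * c); have [N ElN1 NE] := tE (s * c).
  exists (M *m N); first exact: elementaryM.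
  rewrite map_mxM ME NE -eichlerD ?bilZr ?uv ?mulr0 // -scalerDl.
  congr (E u (_ *: v)); rewrite -mulrA [t * (s * c)]mulrCA.
  by rewrite mulrDr.
- move=> a d [s Ss sE]; have [t St [b tb]] := loc_frac locf a.
  exists (s * t); first exact: (locM locf).
  move=> c; have [N ElN1 NE] := sE (b * c); exists N => //; rewrite NE.
  by congr (E u (_ *: v)); rewrite !rmorphM -tb; ring.
Qed.

(** A maximal ideal that contains all hyperbolic coordinates of u contains the
remaining coordinate too, because u is isotropic; this contradicts
B(u, w) = 1. *)
Lemma clears_unimodular u v w : B u u = 0 -> B u v = 0 -> B u w = 1 ->
  clears u v 1.
Proof.
move=> uu uv uw; apply: (ideal_has1 (clears_ideal uu uv)) => M maxM.
apply: contrapT => noM.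
have Mh q : M (B (h q) u).
  apply: (@maximal_exp _ _ _ 4 maxM); apply: contrapT => Mq; apply: noM.
  by exists (B (h q) u ^+ 4); first exact: clears_coord.
have [idM _ _] := maxM; have [_ MD MZ] := idM.
have Msum x : M (\sum_q B (h (bar q)) u * B (h q) x).
  by apply: ideal_sum => // q _; rewrite mulrC; apply: MZ.
have Mu0 : M (u 0 0).
  apply: (@maximal_exp _ _ _ 2 maxM).
  have -> : u 0 0 ^+ 2 = - f hf * (\sum_q B (h (bar q)) u * B (h q) u).
    have := bil_expand u u; rewrite uu bil_o => /eqP.
    rewrite eq_sym addrC addr_eq0 => /eqP->.
    by rewrite -[LHS]mul1r -[X in X * _]fhf2; ring.
  exact: MZ.
apply: (maximal_not1 maxM); rewrite -uw bil_expand; apply: MD => //.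
by rewrite mulrC; apply: MZ.
Qed.

(** Conjugation turns E(h p, o) into E(g (h p), g o), and g (h p) is unimodular
because g (h (bar p)) is dual to it. *)
Lemma loc_conj (g g' : 'M[D]_n) p : orth (phi_odd D m) g -> g *m g' = 1%:M ->
  exists2 s, S s & forall c, exists2 N, elementary hf N &
    map_mx f N = g *m E (h p) (f (s * c) *: o) *m g'.
Proof.
move=> Og gg'.
have [||| s Ss sE] := @clears_unimodular (g *m h p) (g *m o) (g *m h (bar p)).
- by rewrite bil_orth // bil_hh0.
- by rewrite bil_orth // bil_ho.
- by rewrite bil_orth // bil_hh eqxx.
exists s => // c; have [N ElN NE] := sE c; exists N => //; rewrite NE mulr1.
by rewrite eichler_conj // -mulmxA gg' mulmx1 scalemxAr.
Qed.

End Conjugation.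

Section Normality.
Variables (A : comNzRingType) (m : nat) (hf : A).
Hypotheses (hf2 : 2%:R * hf = 1) (m1 : (1 < m)%N).
Local Notation n := (2 * m).+1.

(** [loc_conj] for the identity, a localization at {1}. *)
Lemma elementary_normal (g g' M : 'M[A]_n) : orth (phi_odd A m) g -> g *m g' = 1%:M ->
  g' *m g = 1%:M -> elementary hf M -> elementary hf (g *m M *m g').
Proof.
move=> Og gg' g'g [w ->]; elim: w => [|[p c] w IHw].
  by rewrite /word_mx big_nil mulmx1 gg'; apply: elementary1.
rewrite /word_mx big_cons -/(word_mx hf w).
have [_ -> /(_ c)[N ElN]] := loc_conj (loc_id A) hf2 m1 p Og gg'.
rewrite map_mx_id_in // mul1r /= => NE.
have -> : g *m (gen_mx hf (p, c) *m word_mx hf w) *m g'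
  = N *m (g *m word_mx hf w *m g').
  by rewrite NE !mulmxA -(mulmxA _ g' g) g'g mulmx1.
exact: elementaryM.
Qed.

End Normality.

(** * Dilation *)

Definition dilate (R : comNzRingType) (s : R) : {poly R} -> {poly R} :=
  comp_poly (s%:P * 'X).

HB.instance Definition _ (R : comNzRingType) (s : R) :=
  GRing.RMorphism.copy (dilate s) (comp_poly (s%:P * 'X)).

Section Dilation.
Variables (C D : comNzRingType) (S : set C) (f : {rmorphism C -> D}).
Variables (m : nat) (hf : C).
Hypotheses (locf : localization S f) (hf2 : 2%:R * hf = 1) (m1 : (1 < m)%N).
Local Notation n := (2 * m).+1.

Lemma map_dilate s p : map_poly f (dilate s p) = dilate (f s) (map_poly f p).
Proof. by rewrite /dilate map_comp_poly rmorphM /= map_polyC map_polyX. Qed.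

Let hfP : {poly C} := hf%:P.
Let hfP2 : 2%:R * hfP = 1.
Proof. by rewrite -polyC_natr -polyCM hf2. Qed.

Lemma poly_split0 (R : comNzRingType) (q : {poly R}) :
  exists q1, q = 'X * q1 + (q`_0)%:P.
Proof.
elim/poly_ind: q => [|q c _]; first by exists 0; rewrite mulr0 coef0 add0r.
by exists q; rewrite coefD coefMX coefC add0r commr_polyX.
Qed.

Lemma dilateC (R : comNzRingType) (s c : R) : dilate s c%:P = c%:P.
Proof. exact: comp_polyC. Qed.

Lemma dilate0 (R : comNzRingType) (p : {poly R}) : dilate 0 p = (p`_0)%:P.
Proof. by rewrite /dilate mul0r comp_poly0r. Qed.

Lemma dilate_dilate (R : comNzRingType) (s r : R) p :
  dilate r (dilate s p) = dilate (s * r) p.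
Proof.
rewrite /dilate -comp_polyA rmorphM /= comp_polyC comp_polyX polyCM.
by rewrite mulrA.
Qed.

Lemma dilate_killed (R : comNzRingType) (r : R) p :
  dilate 0 p = 0 -> r%:P * p = 0 -> dilate r p = 0.
Proof.
have [q qE] := poly_split0 p; rewrite dilate0 => p0.
move: qE; rewrite p0 addr0 => -> rq.
have {}rq : r%:P * q = 0.
  apply/polyP=> i; have := congr1 (fun u : {poly R} => u`_i.+1) rq.
  by rewrite mulrCA coefXM !coef0.
by rewrite rmorphM /= {1}/dilate comp_polyX mulrAC -(dilateC r r) -rmorphM rq
  rmorph0 mul0r.
Qed.

(** Write q(Y) = q(0) + Y q1(Y): after dilation, the factor Y contributes s, which
clears the denominators of q1, and the prescribed factor s0. *)
Lemma dilate_split (q : {poly D}) s0 :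
  exists2 s, S s & forall t, exists c : {poly C},
  dilate (f (s0 * s * t)) q = map_poly f (s0%:P * c) + (q`_0)%:P.
Proof.
have [q1 qE] := poly_split0 q.
have [_ [s Ss <-] [F FE]] := loc_frac (loc_poly locf) q1.
exists s => // t; exists (t%:P * 'X * dilate (s0 * s * t) F).
rewrite {1}qE /dilate comp_polyD comp_polyM comp_polyX comp_polyC; congr (_ + _).
have FD a : map_poly f (dilate a F) = (f s)%:P * (q1 \Po ((f a)%:P * 'X)).
  by rewrite map_dilate -FE /dilate comp_polyM /= map_polyC comp_polyC.
rewrite 3!(rmorphM (map_poly f)) /= FD !map_polyC map_polyX /=.
have -> : f (s0 * s * t) = f s0 * f s * f t by rewrite !rmorphM.
by rewrite !polyCM; ring.
Qed.

(** The word is treated from the right: splitting the last coefficient q into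
q(0) and the rest, the rest is conjugated by the value W0 at 0 of the preceding
letters, and [loc_conj] makes the conjugate integral.  The statement holds for
all multiples of s, because the induction has to enlarge s. *)
Lemma dilate_word (w : seq ('I_(2 * m) * {poly D})) :
  exists2 s, S s & forall t, exists2 N, elementary hfP N &
    map_mx (map_poly f) N *m map_mx (dilate 0) (word_mx (f hf)%:P w)
      = map_mx (dilate (f (s * t))) (word_mx (f hf)%:P w).
Proof.
have fhfE : (f hf)%:P = map_poly f hfP by rewrite map_polyC.
have fhf2 : 2%:R * (f hf)%:P = 1 :> {poly D}.
  by rewrite fhfE; apply: half_map.
elim/last_ind: w => [|w [p q] [s0 Ss0 IHw]].
  exists 1; first exact: (loc1 locf).
  move=> t; exists 1%:M; first exact: elementary1.
  by rewrite /word_mx big_nil !map_mx1 ?mulmx1.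
pose W0 := map_mx (dilate 0) (word_mx (f hf)%:P w).
have ElW0 : elementary (f hf)%:P W0.
  have -> : (f hf)%:P = dilate 0 (f hf)%:P by rewrite dilateC.
  by apply: (map_elementary (dilate 0)); exists w.
have [V ElV [W0V VW0]] := elementary_has_inv fhf2 ElW0.
have [_ [s1 Ss1 <-] conjE] :=
  loc_conj (loc_poly locf) hfP2 m1 p (elementary_orth fhf2 ElW0) W0V.
have [s2 Ss2 qE] := dilate_split q s1.
exists (s0 * s1 * s2); first by do !apply: (locM locf) => //.
move=> t; have [c cE] := qE (s0 * t); have [N ElN NE] := IHw (s1 * s2 * t).
have [L ElL LE] := conjE c.
exists (N *m L); first exact: elementaryM.
have sE1 : s0 * (s1 * s2 * t) = s0 * s1 * s2 * t by ring.
have sE2 : s1 * s2 * (s0 * t) = s0 * s1 * s2 * t by ring.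
rewrite sE1 in NE; rewrite sE2 in cE.
rewrite -cats1 /word_mx big_cat big_seq1 -/(word_mx _ w) !map_mxM /=.
have genE a : map_mx (dilate a) (gen_mx (f hf)%:P (p, q))
  = gen_mx (f hf)%:P (p, dilate a q).
  by rewrite (map_gen_mx (dilate a)) /= dilateC.
rewrite !genE cE dilate0 -NE -/W0 LE.
rewrite /gen_mx /= scalerDl eichlerD ?bilZr ?bil_ho ?bil_hh0 ?mulr0 //.
by rewrite fhfE !mulmxA -(mulmxA _ V) VW0 mulmx1.
Qed.

(** Up to dilation, M and an integral elementary matrix K with K(0) = 1 agree over
D[Y].  Their difference Q is killed by some r in S and vanishes at Y = 0, so
the dilation by r kills it. *)
Theorem loc_elementary (M : 'M[{poly C}]_n) :
    map_mx (dilate 0) M = 1%:M ->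
    elementary (f hf)%:P (map_mx (map_poly f) M) ->
  exists2 s, S s & elementary hfP (map_mx (dilate s) M).
Proof.
move=> dilM0 [w wE]; have [s Ss sE] := dilate_word w; have [N ElN NE] := sE 1.
rewrite mulr1 in NE.
have dilM (R : comNzRingType) (a b : R) (K : 'M[{poly R}]_n) :
    map_mx (dilate b) (map_mx (dilate a) K) = map_mx (dilate (a * b)) K.
  by rewrite -map_mx_comp; apply: eq_map_mx => p /=; apply: dilate_dilate.
have dilMf s0 (K : 'M[{poly C}]_n) :
    map_mx (map_poly f) (map_mx (dilate s0) K)
    = map_mx (dilate (f s0)) (map_mx (map_poly f) K).
  by rewrite -!map_mx_comp; apply: eq_map_mx => p /=; apply: map_dilate.
have w0 : map_mx (dilate 0) (word_mx (f hf)%:P w) = 1%:M.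
  by rewrite -wE -(rmorph0 f) -dilMf dilM0 map_mx1.
rewrite w0 mulmx1 -wE in NE.
pose N0 := map_mx (dilate 0) N.
have ElN0 : elementary hfP N0.
  have -> : hfP = dilate 0 hfP by rewrite dilateC.
  exact: (map_elementary (dilate 0)).
have [V ElV [N0V VN0]] := elementary_has_inv hfP2 ElN0.
pose K := N *m V; have ElK : elementary hfP K by apply: elementaryM.
have fN0 : map_mx (map_poly f) N0 = 1%:M.
  by rewrite dilMf rmorph0 NE dilM mulr0 -(rmorph0 f) -dilMf dilM0 map_mx1.
have fV : map_mx (map_poly f) V = 1%:M.
  by rewrite -[LHS]mul1mx -fN0 -map_mxM N0V map_mx1.
pose Q := map_mx (dilate s) M - K.
have fQ : map_mx (map_poly f) Q = 0.
  by rewrite /Q map_mxB map_mxM fV mulmx1 dilMf NE subrr.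
have Q0 : map_mx (dilate 0) Q = 0.
  have dilN0 : map_mx (dilate 0) N0 = N0 by rewrite /N0 dilM mul0r.
  have dilV : V = map_mx (dilate 0) V.
    have N0V' : N0 *m map_mx (dilate 0) V = 1%:M.
      by rewrite -{1}dilN0 -map_mxM N0V map_mx1.
    by rewrite -[LHS]mulmx1 -N0V' mulmxA VN0 mul1mx.
  rewrite /Q map_mxB dilM map_mxM mulr0 dilM0.
  by rewrite -/N0 -dilV N0V subrr.
have [_ [r Sr <-] rQ] := loc_ker_mx (loc_poly locf) fQ.
have rQ0 : map_mx (dilate r) Q = 0.
  apply/matrixP=> i j; rewrite !mxE.
  apply: dilate_killed; first by have /matrixP/(_ i j) := Q0; rewrite !mxE.
  by have /matrixP/(_ i j) := rQ; rewrite !mxE.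
exists (s * r); first exact: (locM locf).
have -> : map_mx (dilate (s * r)) M = map_mx (dilate r) K.
  by apply/eqP; rewrite -subr_eq0 -dilM -map_mxB rQ0.
have -> : hfP = dilate r hfP by rewrite dilateC.
exact: (map_elementary (dilate r)).
Qed.

End Dilation.

(** * Orthogonal matrices over a local ring *)

(** For a nonzero commutative ring this says that the nonunits form an ideal. *)
Definition is_local (A : comNzRingType) :=
  forall x y : A, invertible (x + y) -> invertible x \/ invertible y.

Section LocalDecomposition.
Variables (A : comNzRingType) (m : nat) (hf : A).
Hypotheses (locA : is_local A) (hf2 : 2%:R * hf = 1).
Local Notation n := (2 * m).+1.
Local Notation phi := (phi_odd A m).
Local Notation "'B'" := (bil phi).
Local Notation "'E'" := (eichler phi hf).
Local Notation o := (@ov A m).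
Local Notation h := (@hv A m).
Local Notation elementary := (@elementary A m hf).
Local Notation orth := (orth phi).
Implicit Types (p q : 'I_(2 * m)) (u v w x y : 'cV[A]_n) (M N g e : 'M[A]_n).

Lemma invertibleMl (x y : A) : invertible (x * y) -> invertible x.
Proof. by move=> [z xyz]; exists (y * z); rewrite mulrA. Qed.

Lemma invertibleMr (x y : A) : invertible (x * y) -> invertible y.
Proof. by rewrite mulrC; apply: invertibleMl. Qed.

Lemma invertible0 : ~ invertible (0 : A).
Proof. by move=> [y]; rewrite mul0r => /eqP; rewrite eq_sym oner_eq0. Qed.

Lemma invertible_sum (I : finType) (P : pred I) (F : I -> A) :
  invertible (\sum_(i | P i) F i) -> exists2 i, P i & invertible (F i).
Proof.
elim/big_ind: _ => [/invertible0//|x y IHx IHy /locA[]//|i Pi Fi]; by exists i.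
Qed.

(** If the coordinate of u along o is a unit, then so is the sum of the products of
hyperbolic coordinates, which is - 2 times its square since u is isotropic. *)
Lemma unimodular_coord u w : B u u = 0 -> B u w = 1 ->
  exists q, invertible (B (h q) u).
Proof.
have sumP x : invertible (\sum_q B (h (bar q)) u * B (h q) x) ->
    exists q, invertible (B (h q) u).
  by case/invertible_sum=> q _ /invertibleMl; exists (bar q).
move=> uu uw; have : invertible (B u w) by rewrite uw; exists 1; rewrite mulr1.
rewrite bil_expand => /locA[/invertibleMl [z uz]|]; last exact: sumP.
apply: (sumP u); exists (- (hf * z * z)).
have := bil_expand u u; rewrite uu bil_o => /eqP.
rewrite eq_sym addrC addr_eq0 => /eqP->.
transitivity ((2%:R * hf) * (u 0 0 * z) * (u 0 0 * z)); first by ring.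
by rewrite hf2 uz !mulr1.
Qed.

(* The first k hyperbolic planes, that is, the indices p < 2 k. *)
Definition diag_upto k g := forall p, (p < 2 * k)%N -> exists c, g *m h p = c *: h p.
Definition fixes k e := forall p, (p < 2 * k)%N -> e *m h p = h p.
Definition perp k u := forall p, (p < 2 * k)%N -> B (h p) u = 0.

Lemma bar_lt k p : (bar p < 2 * k)%N = (p < 2 * k)%N.
Proof. by rewrite /= /barn; case: ifP => op; lia. Qed.

Lemma fixes_eichler k q y : (2 * k <= q)%N -> perp k y -> fixes k (E (h q) y).
Proof.
move=> kq py p pk; apply: eichler_fix; last by rewrite bilC // py.
rewrite bil_hh; case: eqP => // pq; move: pk; rewrite pq bar_lt; lia.
Qed.

Lemma fixesM k e e' : fixes k e -> fixes k e' -> fixes k (e *m e').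
Proof. by move=> fe fe' p pk; rewrite -mulmxA fe' // fe. Qed.

Lemma fixes_perp k e u : orth e -> fixes k e -> perp k u -> perp k (e *m u).
Proof. by move=> Oe fe pu p pk; rewrite -(fe p pk) bil_orth // pu. Qed.

Lemma diag_unit k g p : orth g -> diag_upto k g -> (p < 2 * k)%N ->
  exists2 c, invertible c & g *m h p = c *: h p.
Proof.
move=> Og dg pk; have [c gp] := dg p pk.
have [|d gbp] := dg (bar p); first by rewrite bar_lt.
exists c => //; exists d; have : B (g *m h p) (g *m h (bar p)) = 1.
  by rewrite bil_orth // bil_hh eqxx.
by rewrite gp gbp bilZl // bilZr bil_hh eqxx mulr1.
Qed.

Lemma diag_perp k g u : orth g -> diag_upto k g -> perp k u -> perp k (g *m u).
Proof.
move=> Og dg pu p pk; have [c [d cd] gp] := diag_unit Og dg pk.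
have := pu p pk; rewrite -(bil_orth _ _ Og) gp bilZl //.
move=> /(congr1 (fun z : A => d * z)).
by rewrite mulr0 mulrA (mulrC d) cd mul1r.
Qed.

(** E(h p, y) removes from u its components outside the plane of h p; the
component along h p then vanishes because the image is isotropic and a is a
unit. *)
Lemma clear_vector k p u a : (2 * k <= p)%N -> B u u = 0 -> perp k u ->
    B (h p) u = a -> invertible a ->
  exists e, [/\ elementary e, fixes k e, e *m h p = h p & e *m u = a *: h (bar p)].
Proof.
move=> kp uu pu pua [a' aa']; set d := B (h (bar p)) u.
pose y := a' *: (u - a *: h (bar p) - d *: h p).
have hpy : B (h p) y = 0.
  by rewrite !bilE // pua bil_hh0 bil_hh eqxx !mulr1 mulr0 !subrr mulr0.
have eE : E (h p) y *m u = a *: h (bar p) + (B y u - qf phi hf y * a + d) *: h p.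
  rewrite eichlerE pua; have -> : a *: y = u - a *: h (bar p) - d *: h p.
    by rewrite scalerA aa' scale1r.
  apply/matrixP=> i j; rewrite !mxE; ring.
have Oe : orth (E (h p) y) by apply: eichler_orth => //; apply: bil_hh0.
exists (E (h p) y); split.
- exact: elementary_hv.
- apply: fixes_eichler => // q qk; rewrite !bilE // pu // !bil_hh.
  have -> : (bar p == bar q) = false.
    by rewrite (inj_eq (@bar_inj m)) -val_eqE /=; lia.
  have -> : (p == bar q) = false.
    by apply/negbTE/eqP => pq; move: kp; rewrite pq leqNgt bar_lt qk.
  by rewrite !mulr0 !subr0 mulr0.
- by apply: eichler_fix; rewrite ?bil_hh0 // bilC.
set c := B y u - _ + d in eE.
have : B (E (h p) y *m u) (E (h p) y *m u) = 0 by rewrite bil_orth.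
rewrite eE !bilE // !bil_hh0 !bil_hh barK !eqxx mulr1n => zz.
have ac : a * c + c * a = 0 by rewrite -zz; ring.
suff -> : c = 0 by rewrite scale0r addr0.
transitivity ((2%:R * hf) * (a * a') * c); first by rewrite hf2 aa' !mul1r.
transitivity (hf * a' * (a * c + c * a)); first by ring.
by rewrite ac mulr0.
Qed.

(** If the unit coordinate b of u is in another plane, E(h p, h q) adds it to a.  If
it is the coordinate dual to a, then E(h p, o) and E(h p, - o) change a to
a + c - b and a - c - b, where c = B(o, u); if both were nonunits, so would be
b, as a is one. *)
Lemma make_unit k p u w : (2 * k <= p)%N -> B u u = 0 -> perp k u -> B u w = 1 ->
  exists e, [/\ elementary e, fixes k e & invertible (B (h (bar p)) (e *m u))].
Proof.
move=> kp uu pu uw; have [q uq] := unimodular_coord uu uw.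
set a := B (h (bar p)) u; set b := B (h q) u.
have kq : (2 * k <= q)%N.
  by rewrite leqNgt; apply/negP => qk; apply: invertible0; rewrite -(pu q qk).
have [a1|a1] := pselect (invertible a).
  exists 1%:M; split; first exact: elementary1.
    by move=> p' _; rewrite mul1mx.
  by rewrite mul1mx.
have aN : ~ invertible (- a).
  by move=> [z az]; apply: a1; exists (- z); rewrite mulrN -mulNr.
have [qp|qp] := eqVneq q (bar p); first by case: a1; rewrite /a -qp.
have [qp'|qp'] := eqVneq q p.
  have eE z : B (h (bar p)) (E (h p) (z *: o) *m u) = a + z * B o u - z ^+ 2 * b.
    rewrite eichlerE qfZ // !bilE // bil_ho bil_hh barK eqxx /qf bil_oo.
    by rewrite (mulrC hf) hf2 -/a /b qp' ?mulr1n; ring.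
  have inv1 : invertible (B (h (bar p)) (E (h p) (1 *: o) *m u)) \/
              invertible (B (h (bar p)) (E (h p) (- 1 *: o) *m u)).
    rewrite !eE; apply: locA; suff : invertible (a + (- hf) *
        ((a + 1 * B o u - 1 ^+ 2 * b) + (a + -1 * B o u - (-1) ^+ 2 * b))).
      by move=> /locA[//|/invertibleMr].
    have -> : a + (- hf) * ((a + 1 * B o u - 1 ^+ 2 * b)
        + (a + -1 * B o u - (-1) ^+ 2 * b)) = (1 - 2%:R * hf) * a + (2%:R * hf) * b.
      ring.
    by rewrite hf2 subrr mul0r add0r mul1r.
  have pko z : perp k (z *: o) by move=> p' _; rewrite bilZr bil_ho mulr0.
  by case: inv1 => inv; [exists (E (h p) (1 *: o)) | exists (E (h p) (- 1 *: o))];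
    split=> //; first [exact: elementary_gen | exact: fixes_eichler].
exists (E (h p) (h q)); split.
- by apply: elementary_hv => //; rewrite bil_hh (negPf qp).
- apply: fixes_eichler => // p' pk; rewrite bil_hh; case: eqP => // qE.
  by move: kq; rewrite qE leqNgt bar_lt pk.
- rewrite eichlerE !bilE // !bil_hh barK eqxx (negPf qp') /qf bil_hh0.
  rewrite !(mulr0, mulr1, mul0r, subr0) -/a -/b.
  have : invertible ((a + b) + - a) by rewrite addrAC subrr add0r.
  by case/locA.
Qed.

(** First the image of h p, then the image of h (bar p), is made a multiple of the
vector itself, with transvections that fix the preceding planes. *)
Lemma diag_step k g : (k < m)%N -> orth g -> diag_upto k g ->
  exists2 e, elementary e & diag_upto k.+1 (e *m g).
Proof.
move=> km Og dg; have k0 : (2 * k < 2 * m)%N by lia.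
pose p := Ordinal k0; have kp : (2 * k <= p)%N by [].
have kbp : (2 * k <= bar p)%N by rewrite leqNgt bar_lt -leqNgt.
have perp_h q : (2 * k <= q)%N -> perp k (h q).
  move=> kq p' pk; rewrite bil_hh; case: eqP => // qE.
  by move: kq; rewrite qE leqNgt bar_lt pk.
set u := g *m h p; have uu : B u u = 0 by rewrite bil_orth // bil_hh0.
have pu : perp k u by apply: diag_perp => //; apply: perp_h.
have uw : B u (g *m h (bar p)) = 1 by rewrite bil_orth // bil_hh eqxx.
have [e1 [Ele1 fe1 inva]] := make_unit kp uu pu uw.
have Oe1 := elementary_orth hf2 Ele1.
have [|| e2 [Ele2 fe2 _ e2u]] := clear_vector kbp _ _ erefl inva.
- by rewrite bil_orth.
- exact: fixes_perp.
rewrite barK in e2u; set a := B _ _ in e2u inva.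
have Oe2 := elementary_orth hf2 Ele2; pose g2 := e2 *m e1 *m g.
have Og2 : orth g2 by do !apply: orthM.
have g2p : g2 *m h p = a *: h p by rewrite -!mulmxA -/u e2u.
have dg2 : diag_upto k g2.
  move=> q qk; have [c gq] := dg q qk; exists c.
  by rewrite /g2 -mulmxA gq -scalemxAr; congr (_ *: _); apply: (fixesM fe2 fe1).
have inva' : invertible (B (h p) (g2 *m h (bar p))).
  exists a; have : B (g2 *m h p) (g2 *m h (bar p)) = 1.
    by rewrite bil_orth // bil_hh eqxx.
  by rewrite g2p bilZl // mulrC.
have [|| e3 [Ele3 fe3 e3p e3u]] := clear_vector kp _ _ erefl inva'.
- by rewrite bil_orth // bil_hh0.
- by apply: diag_perp => //; apply: perp_h.
exists (e3 *m (e2 *m e1)); first by do !apply: elementaryM.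
rewrite -mulmxA -/g2 => q; case: (ltnP q (2 * k)) => [qk _|kq qk].
  have [c gq] := dg2 q qk; exists c.
  by rewrite -mulmxA gq -scalemxAr fe3.
have [->|->] : q = p \/ q = bar p.
- have [q0|q1] : (q = 2 * k :> nat)%N \/ (q = (2 * k).+1 :> nat)%N by lia.
    by left; apply: val_inj.
  by right; apply: val_inj; rewrite /= /barn; case: ifP; lia.
- by exists a; rewrite -mulmxA g2p -scalemxAr e3p.
- by eexists; rewrite -mulmxA e3u.
Qed.

Definition diag_basis g :=
  (exists c, g *m o = c *: o) /\ forall p, exists c, g *m h p = c *: h p.

(** Once all hyperbolic vectors are eigenvectors, o is one too, since it spans
their orthogonal complement. *)
Theorem local_decomposition g : orth g ->
  exists2 e, elementary e & diag_basis (e *m g).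
Proof.
move=> Og; have [e Ele dg] : exists2 e, elementary e & diag_upto m (e *m g).
  suff H k : (k <= m)%N -> exists2 e, elementary e & diag_upto k (e *m g) by apply: H.
  elim: k => [_|k IHk km]; first by exists 1%:M; [apply: elementary1 | move=> p].
  have [e Ele dg] := IHk (ltnW km).
  have [|e' Ele' dg'] := diag_step km _ dg.
    by apply: orthM => //; apply: (elementary_orth hf2).
  by exists (e' *m e); [apply: elementaryM | rewrite -mulmxA].
exists e => //; have Oeg : orth (e *m g).
  by apply: orthM => //; apply: (elementary_orth hf2).
split=> [|p]; last exact: dg.
exists ((e *m g *m o) 0 0); apply: cv_eq => [|p]; first by rewrite !mxE !eqxx mulr1.
have := @diag_perp m _ o Oeg dg; rewrite bilZr bil_ho mulr0; apply=> //.
by move=> q _; rewrite bil_ho.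
Qed.

Lemma diag_basis_comm g k : diag_basis g -> diag_basis k -> g *m k = k *m g.
Proof.
move=> [[c go] gh] [[d ko] kh].
have ogk : g *m k *m o = k *m g *m o.
  by rewrite -!mulmxA ko go -!scalemxAr go ko !scalerA mulrC.
have hgk p : g *m k *m h p = k *m g *m h p.
  have [a gp] := gh p; have [b kp] := kh p.
  by rewrite -!mulmxA kp gp -!scalemxAr gp kp !scalerA mulrC.
apply: mx_ext => x; rewrite [x]cv_expand !mulmxDr -!scalemxAr ogk; congr (_ + _).
by rewrite !mulmx_sumr; apply: eq_bigr => p _; rewrite -!scalemxAr hgk.
Qed.

End LocalDecomposition.

(** * Rings of fractions *)

Record mult_set (A : comNzRingType) := MultSet {
  mset :> A -> Prop;
  mset1 : mset 1;
  msetM : forall s t, mset s -> mset t -> mset (s * t);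
  mset0 : ~ mset 0
}.

Section Fractions.
Local Open Scope quotient_scope.
Variables (A : comNzRingType) (S : mult_set A).

Record ratio := Ratio { numer : A; denom : A; denP : S denom }.

HB.instance Definition _ := gen_eqMixin ratio.
HB.instance Definition _ := gen_choiceMixin ratio.

(** The factor t is necessary in the presence of zero divisors. *)
Definition req (x y : ratio) : bool :=
  `[< exists2 t, S t & t * (numer x * denom y) = t * (numer y * denom x) >].

Lemma reqP x y :
  reflect (exists2 t, S t & t * (numer x * denom y) = t * (numer y * denom x)) (req x y).
Proof. exact: asboolP. Qed.

Lemma req_refl : reflexive req.
Proof. by move=> x; apply/reqP; exists 1 => //; apply: mset1. Qed.

Lemma req_sym : symmetric req.
Proof. by move=> x y; apply/reqP/reqP => -[t St e]; exists t. Qed.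

Lemma req_trans : transitive req.
Proof.
move=> y x z /reqP[t St xy] /reqP[r Sr yz]; apply/reqP.
exists (t * r * denom y); first by do !apply: msetM => //; apply: denP.
transitivity (r * denom z * (t * (numer x * denom y))); first by ring.
rewrite xy; transitivity (t * denom x * (r * (numer y * denom z))); first by ring.
by rewrite yz; ring.
Qed.

Canonical req_equiv := EquivRel req req_refl req_sym req_trans.

Definition fractions := {eq_quot req}.

HB.instance Definition _ : EqQuotient _ req fractions := EqQuotient.on fractions.
HB.instance Definition _ := Choice.on fractions.

Lemma repr_req x : exists2 t, S t &
  t * (numer (repr (\pi_fractions x)) * denom x)
  = t * (numer x * denom (repr (\pi_fractions x))).
Proof. by apply/reqP; rewrite -[req _ _]eqmodE reprK. Qed.

Definition embf (a : A) : ratio := Ratio a (mset1 S).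
Definition addf (x y : ratio) : ratio :=
  Ratio (numer x * denom y + numer y * denom x) (msetM (denP x) (denP y)).
Definition oppf (x : ratio) : ratio := Ratio (- numer x) (denP x).
Definition mulf (x y : ratio) : ratio :=
  Ratio (numer x * numer y) (msetM (denP x) (denP y)).

Definition tofrac := lift_embed fractions embf.
Canonical tofrac_pi_morph := PiEmbed tofrac.

Definition frac_add := lift_op2 fractions addf.
Lemma pi_frac_add : {morph \pi : x y / addf x y >-> frac_add x y}.
Proof.
move=> x y; unlock frac_add; apply/eqmodP => /=; rewrite req_sym; apply/reqP => /=.
have [t St tE] := repr_req x; have [r Sr rE] := repr_req y.
exists (t * r); first exact: msetM.
set x' := repr _ in tE *; set y' := repr _ in rE *.
transitivity (t * (numer x' * denom x) * r * denom y' * denom y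
  + r * (numer y' * denom y) * t * denom x' * denom x); first by ring.
by rewrite tE rE; ring.
Qed.
Canonical pi_frac_add_morph := PiMorph2 pi_frac_add.

Definition frac_opp := lift_op1 fractions oppf.
Lemma pi_frac_opp : {morph \pi : x / oppf x >-> frac_opp x}.
Proof.
move=> x; unlock frac_opp; apply/eqmodP => /=; rewrite req_sym; apply/reqP => /=.
have [t St tE] := repr_req x; exists t => //.
by rewrite !mulNr !mulrN tE.
Qed.
Canonical pi_frac_opp_morph := PiMorph1 pi_frac_opp.

Definition frac_mul := lift_op2 fractions mulf.
Lemma pi_frac_mul : {morph \pi : x y / mulf x y >-> frac_mul x y}.
Proof.
move=> x y; unlock frac_mul; apply/eqmodP => /=; rewrite req_sym; apply/reqP => /=.
have [t St tE] := repr_req x; have [r Sr rE] := repr_req y.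
exists (t * r); first exact: msetM.
set x' := repr _ in tE *; set y' := repr _ in rE *.
transitivity (t * (numer x' * denom x) * (r * (numer y' * denom y))); first by ring.
by rewrite tE rE; ring.
Qed.
Canonical pi_frac_mul_morph := PiMorph2 pi_frac_mul.

Lemma ratio_eq (x y : ratio) : numer x * denom y = numer y * denom x ->
  \pi_fractions x = \pi_fractions y.
Proof.
move=> xy; apply/eqmodP => /=; apply/reqP.
by exists 1; rewrite ?xy //; apply: mset1.
Qed.

Lemma frac_addA : associative frac_add.
Proof.
elim/quotW=> x; elim/quotW=> y; elim/quotW=> z; rewrite !piE.
by apply: ratio_eq => /=; ring.
Qed.

Lemma frac_addC : commutative frac_add.
Proof.
by elim/quotW=> x; elim/quotW=> y; rewrite !piE; apply: ratio_eq => /=; ring.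
Qed.

Lemma frac_add0 : left_id (tofrac 0) frac_add.
Proof. by elim/quotW=> x; rewrite !piE; apply: ratio_eq => /=; ring. Qed.

Lemma frac_addN : left_inverse (tofrac 0) frac_opp frac_add.
Proof. by elim/quotW=> x; rewrite !piE; apply: ratio_eq => /=; ring. Qed.

HB.instance Definition _ :=
  GRing.isZmodule.Build fractions frac_addA frac_addC frac_add0 frac_addN.

Lemma frac_mulA : associative frac_mul.
Proof.
elim/quotW=> x; elim/quotW=> y; elim/quotW=> z; rewrite !piE.
by apply: ratio_eq => /=; ring.
Qed.

Lemma frac_mulC : commutative frac_mul.
Proof.
by elim/quotW=> x; elim/quotW=> y; rewrite !piE; apply: ratio_eq => /=; ring.
Qed.

Lemma frac_mul1 : left_id (tofrac 1) frac_mul.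
Proof. by elim/quotW=> x; rewrite !piE; apply: ratio_eq => /=; ring. Qed.

Lemma frac_mulDl : left_distributive frac_mul frac_add.
Proof.
elim/quotW=> x; elim/quotW=> y; elim/quotW=> z; rewrite !piE.
by apply: ratio_eq => /=; ring.
Qed.

Lemma tofrac_eq0 a : tofrac a = tofrac 0 -> exists2 s, S s & s * a = 0.
Proof.
rewrite !piE => /eqmodP /= /reqP[t St] /=; rewrite !mulr1 mulr0 => ta.
by exists t.
Qed.

Lemma frac_nonzero1 : tofrac 1 != tofrac 0 :> fractions.
Proof.
apply/eqP => /tofrac_eq0[s Ss]; rewrite mulr1 => s0.
by apply: (@mset0 _ S); rewrite -s0.
Qed.

HB.instance Definition _ :=
  GRing.Zmodule_isComNzRing.Build fractions
    frac_mulA frac_mulC frac_mul1 frac_mulDl frac_nonzero1.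

Lemma tofrac_zmod : zmod_morphism tofrac.
Proof.
move=> a b; change (tofrac (a - b) = frac_add (tofrac a) (frac_opp (tofrac b))).
by rewrite !piE; apply: ratio_eq => /=; ring.
Qed.

Lemma tofrac_monoid : monoid_morphism tofrac.
Proof.
split=> // a b; change (tofrac (a * b) = frac_mul (tofrac a) (tofrac b)).
by rewrite !piE; apply: ratio_eq => /=; ring.
Qed.

HB.instance Definition _ :=
  GRing.isZmodMorphism.Build A fractions tofrac tofrac_zmod.
HB.instance Definition _ :=
  GRing.isMonoidMorphism.Build A fractions tofrac tofrac_monoid.

Lemma fractions_loc : localization S (tofrac : {rmorphism A -> fractions}).
Proof.
split; [exact: mset1 | exact: msetM | | | exact: tofrac_eq0] => /=.
- move=> s Ss; exists (\pi_fractions (Ratio 1 Ss)).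
  change (frac_mul (tofrac s) (\pi_fractions (Ratio 1 Ss)) = tofrac 1).
  by rewrite !piE; apply: ratio_eq => /=; ring.
- elim/quotW=> x; exists (denom x); first exact: denP.
  exists (numer x).
  change (frac_mul (tofrac (denom x)) (\pi_fractions x) = tofrac (numer x)).
  by rewrite !piE; apply: ratio_eq => /=; ring.
Qed.

End Fractions.

Section LocalRings.
Variable A : comNzRingType.

Lemma maximal_compl (M : set A) : maximal_ideal M ->
  exists S : mult_set A, mset S = (~` M)%classic.
Proof.
move=> maxM; have [[M0 _ _] _ _] := maxM.
have M1 : ~ M 1 := maximal_not1 maxM.
have MM s t : ~ M s -> ~ M t -> ~ M (s * t).
  by move=> Ms Mt /(maximal_prime maxM)[].
have N0 : ~ ~ M 0 by [].
by exists (@MultSet A (~` M)%classic M1 MM N0).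
Qed.

Lemma local_localization (D : comNzRingType) (M : set A) (f : {rmorphism A -> D}) :
  maximal_ideal M -> localization (~` M)%classic f -> is_local D.
Proof.
move=> maxM locf x y [z xyz]; have [[_ MD _] _ _] := maxM.
have [s Ss [a sx]] := loc_frac locf x; have [t St [b ty]] := loc_frac locf y.
have inv d r c : f r * d = f c -> (~ M r) -> ~ M c -> invertible d.
  move=> rd Mr Mc; have [e ce] := loc_unit locf Mc; exists (f r * e).
  by rewrite mulrA (mulrC d) rd ce.
have [Ma|Ma] := pselect (M a); last by left; apply: (inv _ s a).
have [Mb|Mb] := pselect (M b); last by right; apply: (inv _ t b).
exfalso; have [r Sr [c rz]] := loc_frac locf z.
have : f ((t * a + s * b) * c - s * t * r) = 0.
  rewrite rmorphB !(rmorphM, rmorphD) -sx -ty -rz.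
  transitivity (f s * f t * f r * ((x + y) * z - 1)); first by ring.
  by rewrite xyz subrr mulr0.
move=> /(loc_ker locf)[q Sq].
rewrite mulrBr => /eqP; rewrite subr_eq0 => /eqP qE.
have [[M0 _ MZ] _ _] := maxM.
have : M (q * (s * t * r)).
  rewrite -qE; apply: (MZ); rewrite mulrC; apply: (MZ).
  by apply: MD; apply: (MZ).
by do 3!(case/(maximal_prime maxM) => //).
Qed.

Lemma local_ring_is_local : local_ring A -> is_local A.
Proof.
move=> [M [maxM uniqM]] x y [z xyz].
have nonunit a : ~ invertible a -> M a.
  move=> aN; have [||N maxN aN'] := @proper_in_maximal A [set a * b | b in setT]%classic.
  - split; first by exists 0 => //; rewrite mulr0.
      by move=> _ _ [b _ <-] [c _ <-]; exists (b + c) => //; rewrite mulrDr.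
    by move=> c _ [b _ <-]; exists (c * b) => //; rewrite mulrCA.
  - by move=> [b _ ab]; apply: aN; exists b.
  by rewrite (uniqM _ maxN); apply: aN'; exists 1; rewrite ?mulr1.
have [ix|/nonunit Mx] := pselect (invertible x); first by left.
have [iy|/nonunit My] := pselect (invertible y); first by right.
exfalso; apply: (maximal_not1 maxM); rewrite -xyz mulrC.
by have [[_ MD MZ] _ _] := maxM; apply: MZ; apply: MD.
Qed.

End LocalRings.

(** * Functoriality and normality in terms of groups *)

Section GLmap.
Variables (A D : comNzRingType) (f : {rmorphism A -> D}) (n : nat).

Fact GLmap_subproof (g : GL n A) :
  is_inverse_pair (map_mx f (val g).1, map_mx f (val g).2).
Proof.
by case: g => [[a b] /= /andP[/eqP /= ab /eqP /= ba]];
  rewrite /is_inverse_pair /= -!map_mxM ab ba map_mx1 eqxx.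
Qed.

Definition GLmap (g : GL n A) : GL n D := MkGL (GLmap_subproof g).

Lemma GLmx_map g : GLmx (GLmap g) = map_mx f (GLmx g). Proof. by []. Qed.

Lemma GLmxM (g h : GL n A) : GLmx (g * h)%g = GLmx g *m GLmx h. Proof. by []. Qed.

Lemma GLmx1 : GLmx (1%g : GL n A) = 1%:M. Proof. by []. Qed.

Lemma GLmapM (g h : GL n A) : GLmap (g * h)%g = (GLmap g * GLmap h)%g.
Proof. by apply: GLmx_inj; rewrite GLmx_map GLmxM map_mxM. Qed.

Lemma GLmapV (g : GL n A) : GLmap g^-1%g = ((GLmap g)^-1)%g.
Proof. by apply: GLmx_inj. Qed.

Lemma GLmap1 : GLmap 1%g = 1%g.
Proof. by apply: GLmx_inj; rewrite GLmx_map GLmx1 map_mx1. Qed.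

Lemma GLmapR (g h : GL n A) : GLmap [~ g, h]%g = [~ GLmap g, GLmap h]%g.
Proof. by rewrite !commgEl !conjgE !(GLmapM, GLmapV). Qed.

End GLmap.

Lemma GLmap_comp (A C D : comNzRingType) (f : {rmorphism A -> C}) (g : {rmorphism C -> D})
    (k : {rmorphism A -> D}) n (x : GL n A) :
  (forall a, g (f a) = k a) -> GLmap g (GLmap f x) = GLmap k x.
Proof.
by move=> gf; apply: GLmx_inj; apply/matrixP=> i j; rewrite !GLmx_map !mxE.
Qed.

Lemma commMgJ (G : groupType) (x y z : G) :
  ([~ x * y, z] = [~ x, z] ^ y * [~ y, z])%g.
Proof. by rewrite !commgEl invgM conjMg (conjgE _ y) !mulgA !mulgK. Qed.

Section CommutatorModulo.
Variables (G : groupType) (N H : set G).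
Hypothesis nNH : normal_subgroup N H.
Local Open Scope group_scope.

Lemma normal_comm k x : N k -> H x -> N [~ k, x].
Proof.
have [_ [_ NM NV] _ NJ] := nNH.
by move=> Nk Hx; rewrite commgEl; apply: NM; [apply: NV | apply: NJ].
Qed.

Lemma comm_modl k x y : N k -> H x -> H y -> N [~ k * x, y] <-> N [~ x, y].
Proof.
have [_ [_ NM NV] _ NJ] := nNH => Nk Hx Hy.
have Nc : N ([~ k, y] ^ x) by apply: NJ => //; apply: normal_comm.
rewrite commMgJ; split=> [NN|NN]; last exact: NM.
by rewrite -[X in N X](mulKg ([~ k, y] ^ x)); apply: NM => //; apply: NV.
Qed.

Lemma subgroup_comm x y : H x -> H y -> H [~ x, y].
Proof.
have [[_ HM HV] _ _ _] := nNH => Hx Hy; rewrite commgEl conjgE.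
by do ?[apply: (HM) | apply: (HV)].
Qed.

Lemma normalV x : N x -> N x^-1. Proof. by have [_ [_ _ NV] _ _] := nNH; apply: NV. Qed.

Lemma normal_commr x k : N k -> H x -> N [~ x, k].
Proof. by move=> Nk Hx; rewrite -invgR; apply: normalV; apply: normal_comm. Qed.

Lemma comm_modr k x y : N k -> H x -> H y -> N [~ x, k * y] <-> N [~ x, y].
Proof.
have commV a b : N [~ a, b] <-> N [~ b, a].
  by split=> /normalV; rewrite invgR.
by move=> Nk Hx Hy; rewrite commV comm_modl // commV.
Qed.

End CommutatorModulo.

Section ElementaryGroup.
Variables (A : comNzRingType) (m : nat) (hf : A).
Hypotheses (hf2 : 2%:R * hf = 1) (m1 : (1 < m)%N).
Local Notation n := (2 * m).+1.
Local Notation phi := (phi_odd A m).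

Lemma EO_normal_O : normal_subgroup (EO_odd A m) (O_odd A m).
Proof.
split; [exact: subgroup_orthogonal | exact: EO_subgroup | exact: EO_sub_O |].
move=> x g /(EO_elementaryP hf2) Ex Og; apply/(EO_elementaryP hf2).
have [_ _ OV] := subgroup_orthogonal phi.
rewrite conjgE !GLmxM mulmxA; apply: (elementary_normal hf2 m1) => //.
- exact: (OV _ Og).
- by rewrite -GLmxM mulVg.
- by rewrite -GLmxM mulgV.
Qed.

Lemma phi_invertible : exists psi, phi *m psi = 1%:M.
Proof.
have phi_h p : phi *m hv p = hv (bar p).
  by have := congr1 trmx (tr_h_phi A p); rewrite trmx_mul !trmxK phi_sym.
have phi_o : phi *m ov = 2%:R *: ov.
  by have := congr1 trmx (tr_o_phi A m); rewrite trmx_mul linearZ /= !trmxK phi_sym.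
exists (phi - (2%:R - hf) *: (ov *m ov^T)); apply: mx_ext => x.
have oo : (@ov A m)^T *m ov = 1%:M.
  by rewrite /ov trmx_delta mul_delta_mx; apply/matrixP=> i j; rewrite !mxE !ord1.
have oh p : (@ov A m)^T *m hv p = 0.
  by rewrite /ov /hv trmx_delta mul_delta_mx_0.
set psi := phi - _.
have psi_o : psi *m ov = hf *: ov.
  by rewrite mulmxBl -scalemxAl -mulmxA oo mulmx1 phi_o -scalerBl subKr.
have psi_h p : psi *m hv p = hv (bar p).
  by rewrite mulmxBl -scalemxAl -mulmxA oh mulmx0 scaler0 subr0 phi_h.
rewrite mul1mx -mulmxA [in RHS](cv_expand x) [in LHS](cv_expand x) !mulmxDr.
rewrite -!scalemxAr psi_o -scalemxAr phi_o (scalerA hf) (mulrC hf) hf2 scale1r.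
congr (_ + _); rewrite !mulmx_sumr; apply: eq_bigr => p _.
by rewrite -!scalemxAr psi_h phi_h barK.
Qed.

(** The form is nondegenerate since 2 is invertible. *)
Lemma orth_det2 M : orth phi M -> \det M ^+ 2 = 1.
Proof.
have [psi pp] := phi_invertible.
move=> /(congr1 (fun X => \det X * \det psi)); rewrite !det_mulmx det_tr.
have dpp : \det phi * \det psi = 1 by rewrite -det_mulmx pp det1.
rewrite dpp => <-; transitivity (\det M ^+ 2 * (\det phi * \det psi)); last by ring.
by rewrite dpp mulr1.
Qed.

(** A generator is the square of another one, and an orthogonal determinant is a
square root of 1. *)
Lemma elementary_det (M : 'M[A]_n) : elementary hf M -> \det M = 1.
Proof.
move=> [w ->]; rewrite /word_mx; elim/big_rec: _ => [|[p c] N _ dN]; first exact: det1.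
rewrite det_mulmx dN mulr1.
have -> : gen_mx hf (p, c) = gen_mx hf (p, hf * c) *m gen_mx hf (p, hf * c).
  rewrite /gen_mx /= -eichlerD ?bilZr ?bil_ho ?bil_hh0 ?mulr0 // -scalerDl.
  by have -> : hf * c + hf * c = c by rewrite -mulrDl -mulr2n -mulr_natl hf2 mul1r.
rewrite det_mulmx -expr2 orth_det2 //; apply: (elementary_orth hf2); exact: elementary_gen.
Qed.

Lemma EO_normal_SO : normal_subgroup (EO_odd A m) (SO_odd A m).
Proof.
have [[O1 OM OV] EOs EOO EOJ] := EO_normal_O; split=> //.
- split=> [|x y [Ox dx] [Oy dy]|x [Ox dx]].
  + by split=> //=; rewrite GLmx1 det1.
  + by split; [apply: OM | rewrite /= GLmxM det_mulmx dx dy mulr1].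
  + split; first exact: OV.
    have : \det (GLmx (x * x^-1)%g) = 1 by rewrite mulgV GLmx1 det1.
    by rewrite GLmxM det_mulmx dx mul1r.
- by move=> x Ex; split; [apply: EOO | apply: elementary_det; apply/(EO_elementaryP hf2)].
- by move=> x y Ex [Oy _]; apply: EOJ.
Qed.

Lemma elementary_EO (M : 'M[A]_n) : elementary hf M ->
  exists2 k, EO_odd A m k & GLmx k = M.
Proof.
move=> EM; have [N _ [MN NM]] := elementary_has_inv hf2 EM.
by have [k kM] := GL_lift MN NM; exists k => //; apply/(EO_elementaryP hf2); rewrite kM.
Qed.

(** Modulo EO, both elements are diagonal, and diagonal matrices commute. *)
Lemma local_comm (x y : GL n A) : is_local A -> O_odd A m x -> O_odd A m y ->
  EO_odd A m [~ x, y]%g.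
Proof.
move=> locA Ox Oy; have [d /elementary_EO[k Ek <-] dx] := local_decomposition locA hf2 Ox.
have [e /elementary_EO[l Ell <-] ey] := local_decomposition locA hf2 Oy.
have nEO := EO_normal_O; have [[_ OM _] _ EOO _] := nEO.
apply/(comm_modl nEO Ek Ox Oy); apply/(comm_modr nEO Ell) => //.
  by apply: OM => //; apply: EOO.
suff -> : [~ k * x, l * y]%g = 1%g by have [] := EO_subgroup A m.
apply/eqP/commgP; rewrite /commute; apply: GLmx_inj; exact: diag_basis_comm.
Qed.

End ElementaryGroup.

(** * Commutators over a polynomial ring *)

Section Functor.
Variables (A D : comNzRingType) (f : {rmorphism A -> D}) (m : nat) (hf : A).
Hypothesis hf2 : 2%:R * hf = 1.
Local Notation n := (2 * m).+1.

Lemma GLmap_EO (g : GL n A) : EO_odd A m g -> EO_odd D m (GLmap f g).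
Proof.
move=> /(EO_elementaryP hf2) Eg.
by apply/(EO_elementaryP (half_map f hf2)); apply: map_elementary.
Qed.

Lemma GLmap_O (g : GL n A) : O_odd A m g -> O_odd D m (GLmap f g).
Proof. exact: map_orth. Qed.

End Functor.

Section Substitution.
Variables (R E : comNzRingType) (f : {rmorphism R -> E}) (u : E).

(** Evaluation at u of polynomials with coefficients mapped by f. *)
Definition subst : {rmorphism {poly R} -> E} :=
  horner_morph (fun a : R => mulrC u (f a) : GRing.comm u (f a)).

Lemma substX : subst 'X = u. Proof. exact: horner_morphX. Qed.
Lemma substC c : subst c%:P = f c. Proof. exact: horner_morphC. Qed.

End Substitution.

Lemma poly_hom_eq (R E : comNzRingType) (f g : {rmorphism {poly R} -> E}) :
  (forall c, f c%:P = g c%:P) -> f 'X = g 'X -> f =1 g.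
Proof.
move=> fgC fgX; elim/poly_ind => [|p c IHp]; first by rewrite !rmorph0.
by rewrite !rmorphD !rmorphM IHp fgC fgX.
Qed.

Section PolynomialCommutators.
Variables (R : comNzRingType) (m : nat) (hf : R).
Hypotheses (hf2 : 2%:R * hf = 1) (m1 : (1 < m)%N).
Local Notation n := (2 * m).+1.
Local Notation A := {poly R}.
Local Notation AT := {poly A}.
Local Notation ATY := {poly AT}.
Local Notation EO B := (EO_odd B m).
Local Notation OO B := (O_odd B m).

Let hfA2 : 2%:R * hf%:P = 1 :> A.
Proof. by rewrite -polyC_natr -polyCM hf2. Qed.

Definition ev (t : A) : {rmorphism A -> A} := comp_poly t.

(** Quantifying over all local rings covers both the localizations of R[X] and
the evaluation at 0. *)
Definition locally_elementary (g : GL n A) :=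
  OO A g /\ forall (B : comNzRingType) (f : {rmorphism A -> B}),
    is_local B -> EO B (GLmap f g).

Variables (a b : GL n A).
Hypotheses (Oa : OO A a) (a0 : GLmap (horner_eval 0) a = 1%g).
Hypothesis Kb : locally_elementary b.

Definition comm_at (t : A) := EO A [~ GLmap (ev t) a, b]%g.

Let nEO : normal_subgroup (EO A) (OO A) := EO_normal_O hfA2 m1.

Lemma comm_at_ideal :
  ideal (fun s : A => forall t y, comm_at t -> comm_at (t + s * y)).
Proof.
split=> [t y|r s Pr Ps t y gt|r s Ps t y gt].
- by rewrite mul0r addr0.
- by rewrite mulrDl addrA; apply: Ps; apply: Pr.
- by rewrite (mulrC r) -mulrA; apply: Ps.
Qed.

(** The matrix d is a(T)^-1 a(T + Y), with T the variable of A[T] and Y the outer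
variable.  Since b is elementary over the localization and EO is normal there,
[d, b] is elementary over D[T][Y], where D is the localization of A at M,
and it is 1 at Y = 0.  So [loc_elementary] provides s outside M such that [d(sY), b] is
elementary, and this is specialized at T = t, Y = y. *)
Lemma comm_at_local (M : set A) : maximal_ideal M ->
  exists2 s, (forall t y, comm_at t -> comm_at (t + s * y)) & ~ M s.
Proof.
move=> maxM; have [S SE] := maximal_compl maxM.
pose D : comNzRingType := fractions S.
pose f : {rmorphism A -> D} := tofrac S.
have locf : localization S f := fractions_loc S.
have locD : is_local D.
  by apply: (local_localization (f := f) maxM); rewrite -SE.
have Eb : EO D (GLmap f b) by have [_] := Kb; apply.
pose iA : {rmorphism A -> ATY} := polyC \o polyC.
pose iR : {rmorphism R -> ATY} := iA \o polyC.
pose T : ATY := ('X)%:P.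
pose aT := GLmap (subst iR T) a; pose aTY := GLmap (subst iR (T + 'X)) a.
pose bb := GLmap iA b; pose d := (aT^-1 * aTY)%g.
pose F : {rmorphism ATY -> {poly {poly D}}} := map_poly (map_poly f).
have hfT2 : 2%:R * hf%:P%:P = 1 :> AT by rewrite -polyC_natr -polyCM hfA2.
have hfTY2 : 2%:R * hf%:P%:P%:P = 1 :> ATY by rewrite -polyC_natr -polyCM hfT2.
have Od : OO ATY d.
  have [_ OM OV] := @subgroup_orthogonal n ATY (phi_odd ATY m).
  by apply: (OM); first apply: (OV); apply: GLmap_O.
have [_ [s Ss <-] Es] : exists2 s, [set s%:P | s in S : set A]%classic s &
    elementary hf%:P%:P%:P (map_mx (dilate s) (GLmx [~ d, bb]%g)).
  apply: (loc_elementary (loc_poly locf) hfT2 m1).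
    have d1 : GLmap (dilate 0) d = 1%g.
      rewrite GLmapM GLmapV; suff -> : GLmap (dilate 0) aTY = GLmap (dilate 0) aT.
        by rewrite mulVg.
      rewrite (GLmap_comp (k := dilate 0 \o subst iR T)) //.
      rewrite (GLmap_comp (k := dilate 0 \o subst iR T)) //.
      apply: (@poly_hom_eq R _ (dilate 0 \o subst iR (T + 'X))
        (dilate 0 \o subst iR T)).
        by move=> c; exact: congr1 (etrans (substC _ _ c) (esym (substC _ _ c))).
      rewrite /= !substX rmorphD /= [dilate 0 'X]dilate0 coefX addr0.
      by [].
    by rewrite -GLmx_map GLmapR d1 comm1g GLmx1.
  have -> : (map_poly f hf%:P%:P)%:P = F hf%:P%:P%:P by rewrite /F /= [RHS]map_polyC.
  rewrite -[map_mx _ _](GLmx_map F) GLmapR.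
  apply/(EO_elementaryP (half_map F hfTY2)).
  apply: (normal_commr (EO_normal_O (half_map F hfTY2) m1)); last exact: GLmap_O.
  pose cD : {rmorphism D -> {poly {poly D}}} := polyC \o polyC.
  have -> : GLmap F bb = GLmap cD (GLmap f b).
    rewrite [RHS](GLmap_comp (k := cD \o f)) //; apply: GLmap_comp => p.
    by rewrite /F /= map_polyC /= map_polyC.
  by apply: GLmap_EO Eb; exact: (half_map f hfA2).
exists s; last by move: Ss; rewrite -[S s]/((mset S) s) SE.
move=> t y gt.
pose e : {rmorphism ATY -> A} := horner_eval t \o horner_eval y%:P.
pose eD : {rmorphism ATY -> A} := e \o dilate s%:P.
have ebb : GLmap eD bb = b.
  apply: GLmx_inj; apply/matrixP=> i j; rewrite !GLmx_map !mxE /= dilateC.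
  by rewrite /horner_eval !hornerC.
have eaT : GLmap eD aT = GLmap (ev t) a.
  rewrite (GLmap_comp (k := ev t)) //.
  apply: (@poly_hom_eq R _ (eD \o subst iR T) (ev t)) => [c|] /=.
    by rewrite substC /= dilateC /horner_eval !hornerC comp_polyC.
  by rewrite substX dilateC /horner_eval hornerC hornerX comp_polyX.
have eaTY : GLmap eD aTY = GLmap (ev (t + s * y)) a.
  rewrite (GLmap_comp (k := ev (t + s * y))) //.
  apply: (@poly_hom_eq R _ (eD \o subst iR (T + 'X)) (ev (t + s * y))) => [c|] /=.
    by rewrite substC /= dilateC /horner_eval !hornerC comp_polyC.
  rewrite substX rmorphD /= dilateC /dilate comp_polyX /horner_eval.
  by rewrite !hornerE comp_polyX.
have Ed : EO A [~ (GLmap (ev t) a)^-1 * GLmap (ev (t + s * y)) a, b]%g.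
  apply/(EO_elementaryP hfA2); rewrite -eaT -eaTY -ebb -GLmapV -GLmapM -GLmapR.
  have := map_elementary e Es; rewrite /= /horner_eval !hornerC.
  by rewrite -map_mx_comp.
have Ot : OO A (GLmap (ev t) a) by apply: GLmap_O.
rewrite /comm_at -(mulVKg (GLmap (ev t) a) (GLmap (ev (t + s * y)) a)) commMgJ.
have [[_ OM OV] [_ EM _] _ EJ] := nEO.
apply: EM => //; apply: EJ => //; apply: OM; first exact: OV.
exact: GLmap_O.
Qed.

(** The ideal of [comm_at_ideal] contains 1, so the step from t = 0 to t = X is
allowed. *)
Lemma comm_elementary_based : EO A [~ a, b]%g.
Proof.
have good1 := ideal_has1 comm_at_ideal comm_at_local.
have -> : a = GLmap (ev (0 + 1 * 'X)) a.
  rewrite mul1r add0r; apply: GLmx_inj; apply/matrixP=> i j.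
  by rewrite GLmx_map mxE /= comp_polyXr.
apply: good1; rewrite /comm_at.
have -> : GLmap (ev 0) a = 1%g.
  have : GLmap (polyC : {rmorphism R -> A}) (GLmap (horner_eval 0) a) = 1%g.
    by rewrite a0 GLmap1.
  rewrite (GLmap_comp (k := ev 0)) // => p.
  by rewrite /= comp_poly0r /horner_eval horner_coef0.
by rewrite comm1g; have [] := EO_subgroup A m.
Qed.

End PolynomialCommutators.

(** * Solvability of the quotient *)

Section LocallyElementary.
Variables (R : comNzRingType) (m : nat) (hf : R).
Hypotheses (locR : is_local R) (hf2 : 2%:R * hf = 1) (m1 : (1 < m)%N).
Local Notation n := (2 * m).+1.
Local Notation A := {poly R}.

Let hfA2 : 2%:R * hf%:P = 1 :> A.
Proof. by rewrite -polyC_natr -polyCM hf2. Qed.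

(** Dividing a by the constant matrix a(0), which is elementary by hypothesis on a,
reduces to [comm_elementary_based]. *)
Lemma locally_elementary_comm (a b : GL n A) :
  locally_elementary a -> locally_elementary b -> EO_odd A m [~ a, b]%g.
Proof.
move=> [Oa Ka] Kb; have [Ob _] := Kb.
pose ev0 : {rmorphism A -> R} := horner_eval 0.
pose c : GL n A := GLmap (polyC : {rmorphism R -> A}) (GLmap ev0 a).
have Ec : EO_odd A m c by apply: (GLmap_EO _ hf2); apply: Ka.
have nEO := EO_normal_O hfA2 m1.
have [[_ OM OV] [_ _ EV] EOO _] := nEO.
have Oca : O_odd A m (c^-1 * a)%g.
  by apply: OM => //; apply: OV; apply: EOO.
apply/(comm_modl nEO (EV _ Ec) Oa Ob).
apply: (comm_elementary_based hf2 m1) => //.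
rewrite GLmapM GLmapV; suff -> : GLmap (horner_eval 0) c = GLmap ev0 a.
  by rewrite mulVg.
apply: GLmx_inj; apply/matrixP=> i j; rewrite !GLmx_map !mxE /=.
by rewrite {1}/horner_eval hornerC.
Qed.

Lemma locally_elementary_subgroup :
  subgroup (SO_odd A m `&` @locally_elementary R m)%classic.
Proof.
have [[S1 SM SV] _ _ _] := EO_normal_SO hfA2 m1.
have E1 B := EO_subgroup B m.
split.
- split=> //; split; first by have [] := S1.
  by move=> B f _; rewrite GLmap1; have [] := E1 B.
- move=> x y [Sx [Ox Kx]] [Sy [Oy Ky]]; split; first exact: SM.
  split; first by have [] := SM _ _ Sx Sy.
  move=> B f locB; rewrite GLmapM; have [_ EM _] := E1 B.
  by apply: EM; [apply: Kx | apply: Ky].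
- move=> x [Sx [Ox Kx]]; split; first exact: SV.
  split; first by have [] := SV _ Sx.
  by move=> B f locB; rewrite GLmapV; have [_ _ EV] := E1 B; apply: EV; apply: Kx.
Qed.

Lemma comm_locally_elementary (x y : GL n A) : SO_odd A m x -> SO_odd A m y ->
  (SO_odd A m `&` @locally_elementary R m)%classic [~ x, y]%g.
Proof.
move=> Sx Sy; have Sxy := subgroup_comm (EO_normal_SO hfA2 m1) Sx Sy.
split=> //; split; first by case: Sxy.
move=> B f locB; rewrite GLmapR; apply: (local_comm (half_map f hfA2) m1) => //.
  by apply: GLmap_O; case: Sx.
by apply: GLmap_O; case: Sy.
Qed.

End LocallyElementary.

Section QuotientValues.
Variables (G : groupType) (N H : set G) (nNH : normal_subgroup N H).
Local Open Scope group_scope.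
Local Notation Q := (quotient_group nNH).

Lemma coset_val1 : coset_val (1 : Q) = lcoset 1 N.
Proof. by rewrite lcoset1. Qed.

Lemma coset_valM (C D : Q) x y : H y ->
  coset_val C = lcoset x N -> coset_val D = lcoset y N ->
  coset_val (C * D) = lcoset (x * y) N.
Proof. by move=> Hy Cx Dy; rewrite /= Cx Dy (setprod_lcoset nNH). Qed.

Lemma coset_valV (C : Q) x : H x -> coset_val C = lcoset x N ->
  coset_val C^-1 = lcoset x^-1 N.
Proof. by move=> Hx Cx; rewrite /= Cx (setinv_lcoset nNH). Qed.

Lemma coset_valR (C D : Q) x y : H x -> H y ->
  coset_val C = lcoset x N -> coset_val D = lcoset y N ->
  coset_val [~ C, D] = lcoset [~ x, y] N.
Proof.
have [[_ HM HV] _ _ _] := nNH => Hx Hy Cx Dy; rewrite !commgEl !conjgE.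
apply: coset_valM; first by do ?[apply: (HM) | apply: (HV)].
  exact: coset_valV.
apply: coset_valM; first exact: HM.
  exact: coset_valV.
exact: coset_valM.
Qed.

(** K contains the derived subgroup of H, and its own derived subgroup is
contained in N. *)
Lemma solvable_quotient (K : set G) : subgroup K -> (K `<=` H)%classic ->
    (forall x y, H x -> H y -> K [~ x, y]) ->
    (forall x y, K x -> K y -> N [~ x, y]) ->
  solvable_length_le2 Q.
Proof.
move=> [K1 KM KV] KH HK KN.
pose D : set Q := [set C | exists2 x, K x & coset_val C = lcoset x N]%classic.
have sub_D : (commutator_subgroup (setT : set Q) setT `<=` D)%classic.
  apply: smallest_sub => [|_ [C _] [C' _ <-]].
    split=> [|C C' [x Kx Cx] [y Ky Cy]|C [x Kx Cx]].
    - by exists 1 => //; apply: coset_val1.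
    - by exists (x * y); [apply: KM | apply: coset_valM => //; apply: KH].
    - by exists x^-1; [apply: KV | apply: coset_valV => //; apply: KH].
  have [x Hx Cx] := quoP C; have [y Hy Cy] := quoP C'.
  by exists [~ x, y]; [apply: HK | apply: coset_valR].
apply/seteqP; split; last first.
  by move=> _ -> X [[X1 _ _] _].
apply: smallest_sub => [|_ [C DC] [C' DC' <-]].
  by split=> [//|_ _ -> ->|_ ->]; rewrite /= ?mulg1 ?invg1.
have [x Kx Cx] := sub_D _ DC; have [y Ky Cy] := sub_D _ DC'.
apply: val_inj; rewrite [LHS](coset_valR (KH _ Kx) (KH _ Ky) Cx Cy).
have [_ [_ NM NV] _ _] := nNH; have Nxy := KN _ _ Kx Ky.
apply/seteqP; split=> [_ [z Nz <-]|z Nz]; first exact: NM.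
exists ([~ x, y]^-1 * z); first by apply: NM => //; apply: NV.
by rewrite mulVKg.
Qed.

End QuotientValues.

Theorem theorem6p5 (R : comNzRingType) (m : nat) :
  noetherian R -> local_ring R -> invertible (2%:R : R) -> (2 <= m)%N ->
  exists nEO : normal_subgroup (EO_odd {poly R} m) (SO_odd {poly R} m),
    solvable_length_le2 (quotient_group nEO).
Proof.
move=> _ locR [hf hf2] m1; have locsR := local_ring_is_local locR.
have hfA2 : 2%:R * hf%:P = 1 :> {poly R} by rewrite -polyC_natr -polyCM hf2.
exists (EO_normal_SO hfA2 m1).
apply: (@solvable_quotient _ _ _ _
  (SO_odd _ m `&` @locally_elementary R m)%classic).
- exact: (locally_elementary_subgroup hf2 m1).
- by move=> x [].
- exact: (comm_locally_elementary hf2 m1).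
- by move=> x y [_ Kx] [_ Ky]; apply: (locally_elementary_comm locsR hf2 m1).
Qed.
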